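(* Let $R$ be an $F$-finite Noetherian commutative ring of prime characteristic $p>0$, let $\mathcal{C}$ be an $R$-Cartier algebra and $M$ a coherent left $\mathcal{C}$-module. In each of the following cases the test module $\tau(M,\mathcal{C})$ exists: (a) $M\subseteq R$ (i.e. as an $R$-module $M$ is an ideal of $R$), or, more generally, $\operatorname{rank}(\underline{M}_{\mathcal{C}})_\eta\le 1$ for each generic point $\eta$ of an irreducible component of $\operatorname{Supp}\underline{M}_{\mathcal{C}}$; (b) $\mathcal{C}$ is principally generated.
   Context: $R$ is $F$-finite if the Frobenius $r\mapsto r^p$ is a finite ring map. $R$-Cartier algebra: an $\mathbb{N}$-graded (generally non-commutative) ring $\mathcal{C}=\bigoplus_{e\ge 0}\mathcal{C}_e$ with a ring homomorphism $R\to\mathcal{C}$ whose image is $\mathcal{C}_0$, such that $r\cdot\phi=\phi\cdot r^{p^e}$ for all $r\in R$, $\phi\in\mathcal{C}_e$. It is principally generated if it is generated as an $R$-algebra by a single homogeneous element $\phi\in\mathcal{C}_e$ for some $e\ge 1$. Every left $\mathcal{C}$-module $M$ is an $R$-module via $R\to\mathcal{C}_0$; it is coherent if it is finitely generated as an $R$-module. Put $\mathcal{C}_+=\bigoplus_{e\ge1}\mathcal{C}_e$ and let $\mathcal{C}_+^nM$ be the $\mathcal{C}$-submodule of $M$ generated by all $\phi_1\cdots\phi_n m$ with $\phi_i\in\mathcal{C}_+$, $m\in M$. $M$ is $F$-pure if $\mathcal{C}_+M=M$. For coherent $M$ the chain $M\supseteq\mathcal{C}_+M\supseteq\mathcal{C}_+^2M\supseteq\cdots$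 stabilizes, and its stable member $\underline{M}_{\mathcal{C}}$ is the largest $F$-pure $\mathcal{C}$-submodule of $M$. The annihilator of $\underline{M}_{\mathcal{C}}$ is a radical ideal, so for a generic point $\eta$ of a component of $\operatorname{Supp}\underline{M}_{\mathcal{C}}$ the module $(\underline{M}_{\mathcal{C}})_\eta$ is a vector space over the residue field of $\eta$, and its rank is its dimension. Test module: $\tau(M,\mathcal{C})$ is the smallest $\mathcal{C}$-submodule $N\subseteq M$ such that $N_\eta=(\underline{M}_{\mathcal{C}})_\eta$ for each generic point $\eta$ of an irreducible component of $\operatorname{Supp}\underline{M}_{\mathcal{C}}$. It ''exists'' if such a smallest submodule exists. *)

(* Defs.v *)
From HB Require Import structures.
From mathcomp Require Import all_boot all_algebra.
From mathcomp Require Import generic_quotient ring_quotient boolp classical_sets ring.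

Set Implicit Arguments.
Unset Strict Implicit.
Unset Printing Implicit Defensive.

Import GRing.Theory.

Local Open Scope classical_set_scope.
Local Open Scope ring_scope.
Local Open Scope quotient_scope.

Definition restrict (R S : pzRingType) (f : {rmorphism R -> S})
  (M : lmodType S) : Type := M.

Section Restrict.
Variables (R S : pzRingType) (f : {rmorphism R -> S}) (M : lmodType S).

HB.instance Definition _ := GRing.Zmodule.copy (restrict f M) M.

Let scale (r : R) (m : restrict f M) : restrict f M := f r *: (m : M).

Fact restrict_scaleA a b v : scale a (scale b v) = scale (a * b) v.
Proof. by rewrite /scale rmorphM scalerA. Qed.

Fact restrict_scale1 : left_id 1 scale.
Proof. by move=> v; rewrite /scale rmorph1 scale1r. Qed.

Fact restrict_scaleDr : right_distributive scale +%R.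
Proof. by move=> a u v; rewrite /scale; exact: scalerDr. Qed.

Fact restrict_scaleDl v : {morph scale^~ v : a b / a + b}.
Proof. by move=> a b; rewrite /scale rmorphD; exact: scalerDl. Qed.

HB.instance Definition _ := GRing.Zmodule_isLmodule.Build R (restrict f M)
  restrict_scaleA restrict_scale1 restrict_scaleDr restrict_scaleDl.

End Restrict.

Definition submodule (R : pzRingType) (V : lmodType R) (N : set V) : Prop :=
  submod_closed [in N].

Definition finitely_generated (R : pzRingType) (V : lmodType R) (N : set V) :=
  exists s : seq V, N = smallest (@submodule R V) [set` s].

(* The submodules of R^o are the ideals of R, the unit ideal included. *)
Definition noetherian_ring (R : comNzRingType) : Prop :=
  forall I : set R^o, submodule I -> finitely_generated I.

Definition finite_ring_map (R S : comNzRingType) (f : {rmorphism R -> S}) :=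
  finitely_generated [set: restrict f S^o].

Definition F_finite (p : nat) (R : comNzRingType) (charR : p \in [pchar R]) :=
  finite_ring_map (pFrobenius_aut charR).

(* The library's bundled type of prime ideals lives in too large a universe   *)
(* for one to form sets of prime ideals; hence this record.                  *)
Record spec (R : comNzRingType) := Spec {
  spec_pred : R -> bool;
  spec_ideal : idealr_closed spec_pred;
  spec_prime : prime_idealr_closed spec_pred
}.

Coercion spec_mem (R : comNzRingType) (P : spec R) : {pred R} := spec_pred P.

HB.instance Definition _ (R : comNzRingType) (P : spec R) :=
  isIdealr.Build R (spec_pred P) (spec_ideal P).
HB.instance Definition _ (R : comNzRingType) (P : spec R) :=
  isPrimeIdealrClosed.Build R (spec_pred P) (@spec_prime R P).

Section Localization.
Variables (R : comNzRingType) (P : spec R).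

Record denominator := Denominator { den :> R; denP : den \notin P }.
HB.instance Definition _ := [isSub for den].
HB.instance Definition _ := [Choice of denominator by <:].

Fact one_notin_prime : 1 \notin P.
Proof. by rewrite (idealr1 (spec_pred P)). Qed.

Fact mul_notin_prime (s t : denominator) : den s * den t \notin P.
Proof. by rewrite (prime_idealrM (spec_pred P)) negb_or !denP. Qed.

Definition den1 := Denominator one_notin_prime.
Definition denM (s t : denominator) := Denominator (mul_notin_prime s t).

Section Module.
Variable V : lmodType R.

Definition loc_equiv (x y : V * denominator) : bool :=
  `[< exists u : denominator,
        den u *: (den y.2 *: x.1) = den u *: (den x.2 *: y.1) >].

Fact loc_equiv_refl : reflexive loc_equiv.
Proof. by move=> x; apply/asboolP; exists den1. Qed.

Fact loc_equiv_sym : symmetric loc_equiv.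
Proof.
by move=> x y; apply/asboolP/asboolP => -[u e]; exists u; rewrite e.
Qed.

Fact loc_equiv_trans : transitive loc_equiv.
Proof.
move=> [y t] [x s] [z w] /asboolP[u /= e] /asboolP[v /= f]; apply/asboolP.
exists (denM (denM u v) t) => /=.
transitivity ((den v * den w) *: (den u *: (den t *: x))).
  by rewrite !scalerA; congr (_ *: _); ring.
rewrite e.
transitivity ((den u * den s) *: (den v *: (den w *: y))).
  by rewrite !scalerA; congr (_ *: _); ring.
by rewrite f !scalerA; congr (_ *: _); ring.
Qed.

Canonical loc_equiv_equiv :=
  EquivRel loc_equiv loc_equiv_refl loc_equiv_sym loc_equiv_trans.

Definition loc : Type := {eq_quot loc_equiv}.
HB.instance Definition _ := EqQuotient.on loc.
HB.instance Definition _ := Choice.on loc.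

Definition frac (v : V) (s : denominator) : loc := \pi_loc (v, s).

Lemma fracP (v w : V) (s t : denominator) :
  frac v s = frac w t <->
  exists u : denominator, den u *: (den t *: v) = den u *: (den s *: w).
Proof.
split; first by move=> /eqmodP /asboolP.
by move=> e; apply/eqmodP/asboolP.
Qed.

Lemma fracW (x : loc) : exists v s, x = frac v s.
Proof. by elim/quotW: x => -[v s]; exists v, s. Qed.

Lemma frac_eq (v w : V) (s t : denominator) :
  den t *: v = den s *: w -> frac v s = frac w t.
Proof. by move=> e; apply/fracP; exists den1; rewrite e. Qed.

Definition loc_add (x y : loc) : loc :=
  let: (v, s) := repr x in let: (w, t) := repr y in
  frac (den t *: v + den s *: w) (denM s t).

Definition loc_opp (x : loc) : loc :=
  let: (v, s) := repr x in frac (- v) s.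

Lemma reprE (v : V) (s : denominator) : exists w t,
  repr (frac v s) = (w, t) /\ frac w t = frac v s.
Proof.
case e: (repr (frac v s)) => [w t]; exists w, t; split=> //.
by rewrite /frac -e reprK.
Qed.

Lemma frac_add v w s t :
  loc_add (frac v s) (frac w t) = frac (den t *: v + den s *: w) (denM s t).
Proof.
have [v' [s' [e /fracP[a ea]]]] := reprE v s.
have [w' [t' [f /fracP[b eb]]]] := reprE w t.
rewrite /loc_add e f; apply/fracP; exists (denM a b) => /=.
rewrite !scalerDr; congr (_ + _).
  transitivity ((den t * den b * den t') *: (den a *: (den s *: v'))).
    by rewrite !scalerA; congr (_ *: _); ring.
  by rewrite ea !scalerA; congr (_ *: _); ring.
transitivity ((den s * den a * den s') *: (den b *: (den t *: w'))).
  by rewrite !scalerA; congr (_ *: _); ring.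
by rewrite eb !scalerA; congr (_ *: _); ring.
Qed.

Lemma frac_opp v s : loc_opp (frac v s) = frac (- v) s.
Proof.
have [v' [s' [e /fracP[a ea]]]] := reprE v s.
by rewrite /loc_opp e; apply/fracP; exists a; rewrite !scalerN ea.
Qed.

Fact loc_addA : associative loc_add.
Proof.
move=> x y z.
have [v [s ->]] := fracW x; have [w [t ->]] := fracW y.
have [z' [r ->]] := fracW z.
rewrite !frac_add; apply: frac_eq => /=.
rewrite !scalerDr !scalerA addrA.
by congr (_ + _ + _); congr (_ *: _); ring.
Qed.

Fact loc_addC : commutative loc_add.
Proof.
move=> x y; have [v [s ->]] := fracW x; have [w [t ->]] := fracW y.
rewrite !frac_add; apply: frac_eq => /=.
by rewrite !scalerDr !scalerA addrC; congr (_ + _); congr (_ *: _); ring.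
Qed.

Fact loc_add0 : left_id (frac 0 den1) loc_add.
Proof.
move=> x; have [v [s ->]] := fracW x.
rewrite frac_add; apply: frac_eq => /=.
by rewrite scaler0 add0r scale1r mul1r.
Qed.

Fact loc_addN : left_inverse (frac 0 den1) loc_opp loc_add.
Proof.
move=> x; have [v [s ->]] := fracW x.
rewrite frac_opp frac_add; apply: frac_eq => /=.
by rewrite scalerN addNr !scaler0.
Qed.

HB.instance Definition _ :=
  GRing.isZmodule.Build loc loc_addA loc_addC loc_add0 loc_addN.

Lemma fracD v w s t :
  frac v s + frac w t = frac (den t *: v + den s *: w) (denM s t).
Proof. exact: frac_add. Qed.

End Module.

Definition loc_act (V : lmodType R) (a : loc R^o) (x : loc V) : loc V :=
  let: (r, s) := repr a in let: (v, t) := repr x in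
  frac ((r : R) *: v) (denM s t).

Lemma loc_actE (V : lmodType R) (r : R) s (v : V) t :
  loc_act (frac (r : R^o) s) (frac v t) = frac (r *: v) (denM s t).
Proof.
have [r' [s' [e /fracP[a ea]]]] := reprE (r : R^o) s.
have [v' [t' [f /fracP[b eb]]]] := reprE v t.
have {}ea : (a : R) * (den s * r') = (a : R) * (den s' * r) := ea.
rewrite /loc_act e f; apply/fracP; exists (denM a b) => /=.
transitivity (((a : R) * (den s * r')) *: (den b *: (den t *: v'))).
  by rewrite !scalerA; congr (_ *: _); ring.
by rewrite ea eb !scalerA; congr (_ *: _); ring.
Qed.

Let regE (a b : R) : a *: (b : R^o) = a * b :> R. Proof. by []. Qed.

Fact loc_actA (V : lmodType R) (a b : loc R^o) (x : loc V) :
  loc_act a (loc_act b x) = loc_act (loc_act a b) x.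
Proof.
have [r [s ->]] := fracW a; have [r' [s' ->]] := fracW b.
have [v [t ->]] := fracW x.
rewrite !loc_actE; apply: frac_eq => /=.
by rewrite regE !scalerA; congr (_ *: _); ring.
Qed.

Fact loc_act1 (V : lmodType R) : left_id (frac (1 : R^o) den1) (@loc_act V).
Proof.
move=> x; have [v [t ->]] := fracW x; rewrite loc_actE; apply: frac_eq => /=.
by rewrite scale1r mul1r.
Qed.

Fact loc_actDr (V : lmodType R) : right_distributive (@loc_act V) +%R.
Proof.
move=> a x y; have [r [s ->]] := fracW a.
have [v [t ->]] := fracW x; have [w [u ->]] := fracW y.
rewrite !(fracD, loc_actE); apply: frac_eq => /=.
by rewrite !scalerDr !scalerA; congr (_ + _); congr (_ *: _); ring.
Qed.

Fact loc_actDl (V : lmodType R) (x : loc V) :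
  {morph (@loc_act V)^~ x : a b / a + b}.
Proof.
move=> a b; have [r [s ->]] := fracW a; have [r' [s' ->]] := fracW b.
have [v [t ->]] := fracW x.
rewrite !(fracD, loc_actE); apply: frac_eq => /=.
rewrite !scalerDr !scalerDl !scalerA -scalerDl !scalerA -scalerDl.
by congr (_ *: _); rewrite !regE; ring.
Qed.

Definition loc_ring : Type := loc R^o.
HB.instance Definition _ := GRing.Zmodule.on loc_ring.

Fact loc_mulA : associative (@loc_act R^o : loc_ring -> _ -> _).
Proof. by move=> a b c; exact: loc_actA. Qed.

Fact loc_mulC : commutative (@loc_act R^o : loc_ring -> _ -> _).
Proof.
move=> a b; have [r [s ->]] := fracW a; have [r' [s' ->]] := fracW b.
by rewrite !loc_actE; apply: frac_eq; rewrite /GRing.scale /=; ring.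
Qed.

Fact loc_mulDl :
  left_distributive (@loc_act R^o : loc_ring -> _ -> _) +%R.
Proof. by move=> a b c; exact: loc_actDl. Qed.

Fact loc_oner_neq0 : (frac (1 : R^o) den1 : loc_ring) != 0.
Proof.
apply/eqP => /fracP[u]; rewrite /GRing.scale /= mul1r !mulr0 !mulr1 => u0.
by have := denP u; rewrite u0 (idealr0 (spec_pred P)).
Qed.

HB.instance Definition _ := GRing.Zmodule_isComNzRing.Build loc_ring
  loc_mulA loc_mulC (@loc_act1 R^o) loc_mulDl loc_oner_neq0.

HB.instance Definition _ (V : lmodType R) :=
  GRing.Zmodule_isLmodule.Build loc_ring (loc V)
    (@loc_actA V) (@loc_act1 V) (@loc_actDr V) (@loc_actDl V).

End Localization.

(* The localization of a submodule N of V, inside that of V. *)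
Definition loc_sub (R : comNzRingType) (P : spec R) (V : lmodType R)
  (N : set V) : set (loc P V) := [set x | exists2 v, N v & exists s, x = frac v s].
Arguments loc_sub {R} P {V} N.

Definition loc_max (R : comNzRingType) (P : spec R) :
  set (loc_ring P) := loc_sub (V := R^o) P [set r | r \in P].

(* Dimension of N_P over the residue field R_P / P R_P, for N_P killed by    *)
(* P R_P. Scalars of the residue field are given by representatives in R_P:  *)
(* the equivalence makes the map from (R_P / P R_P)^d to N_P defined by b    *)
(* well defined and injective, and the previous condition makes it           *)
(* surjective.                                                               *)
Definition has_rank (R : comNzRingType) (P : spec R) (V : lmodType R)
    (N : set V) (d : nat) : Prop :=
  exists b : 'I_d -> loc P V,
    [/\ forall i, loc_sub P N (b i),
        forall x, loc_sub P N x ->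
          exists a : 'I_d -> loc_ring P, x = \sum_(i < d) a i *: b i
      & forall a : 'I_d -> loc_ring P,
          \sum_(i < d) a i *: b i = 0 <-> (forall i, loc_max (a i))].

Section Spectrum.
Variable R : comNzRingType.
Implicit Types (Z S : set (spec R)).

Definition zariski_closed Z : Prop :=
  exists I : set R, Z = [set P : spec R | forall r, I r -> r \in P].

Definition irreducible Z : Prop :=
  Z !=set0 /\ forall A B, zariski_closed A -> zariski_closed B ->
    Z `<=` A `|` B -> Z `<=` A \/ Z `<=` B.

Definition irreducible_component S Z : Prop :=
  [/\ Z `<=` S, irreducible Z
    & forall Z', Z' `<=` S -> irreducible Z' -> Z `<=` Z' -> Z' = Z].

Definition generic_point Z (eta : spec R) : Prop :=
  Z = smallest zariski_closed [set eta].

Definition supp (V : lmodType R) (N : set V) : set (spec R) :=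
  [set P : spec R | loc_sub P N <> [set 0]].

Definition component_generic_point (V : lmodType R) (N : set V)
    (eta : spec R) : Prop :=
  exists2 Z, irreducible_component (supp N) Z & generic_point Z eta.

End Spectrum.

Record cartierAlgebra (p : nat) (R : comNzRingType) := CartierAlgebra {
  cartier_sort :> pzRingType;
  cartier_map : {rmorphism R -> cartier_sort};
  cartier_deg : nat -> set cartier_sort;
  cartier_deg_zmod : forall e, zmod_closed [in cartier_deg e];
  cartier_degM : forall d e x y,
    cartier_deg d x -> cartier_deg e y -> cartier_deg (d + e) (x * y);
  cartier_deg_sum : forall x, exists n (c : nat -> cartier_sort),
    (forall e, cartier_deg e (c e)) /\ x = \sum_(e < n) c e;
  cartier_deg_direct : forall n (c : nat -> cartier_sort),
    (forall e, cartier_deg e (c e)) -> \sum_(e < n) c e = 0 ->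
    forall e, (e < n)%N -> c e = 0;
  cartier_deg0 : range cartier_map = cartier_deg 0;
  cartier_semilinear : forall e r phi, cartier_deg e phi ->
    cartier_map r * phi = phi * cartier_map (r ^+ (p ^ e))
}.

Section Cartier.
Variables (p : nat) (R : comNzRingType) (C : cartierAlgebra p R).

Definition principally_generated : Prop :=
  exists e (phi : C), [/\ (1 <= e)%N, cartier_deg e phi
    & smallest (fun A : set C => subring_closed [in A])
        (range (cartier_map C) `|` [set phi]) = setT].

Definition cartier_plus : set C :=
  [set x | exists n (c : nat -> C),
    (forall e, cartier_deg e.+1 (c e)) /\ x = \sum_(e < n) c e].

Variable M : lmodType C.

Definition cartier_module_R : lmodType R := restrict (cartier_map C) M.

Definition coherent : Prop := finitely_generated [set: cartier_module_R].

Definition cartier_pow (n : nat) : set M :=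
  smallest (@submodule C M)
    [set x | exists (phi : 'I_n -> C) (m : M),
      (forall i, cartier_plus (phi i)) /\ x = (\prod_(i < n) phi i) *: m].

(* The stable member of the chain of the cartier_pow n, and M by convention  *)
(* if the chain is not stationary.                                           *)
Definition stable_submodule : set M :=
  xget setT [set U | exists n0, forall n, (n0 <= n)%N -> cartier_pow n = U].

Definition test_candidate (N : set M) : Prop :=
  submodule N /\
  forall eta, component_generic_point (V := cartier_module_R) stable_submodule eta ->
    loc_sub (V := cartier_module_R) eta N =
    loc_sub (V := cartier_module_R) eta stable_submodule.

Definition is_test_module (N : set M) : Prop :=
  test_candidate N /\ forall N', test_candidate N' -> N `<=` N'.

Definition test_module_exists : Prop := exists N, is_test_module N.

(* An injective R-linear map to R identifies M with an ideal of R. *)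
Definition isomorphic_to_ideal : Prop :=
  exists f : {linear cartier_module_R -> R^o}, injective f.

Definition generic_rank_le1 : Prop :=
  forall eta, component_generic_point (V := cartier_module_R) stable_submodule eta ->
    exists2 d, (d <= 1)%N &
      has_rank (V := cartier_module_R) eta stable_submodule d.

End Cartier.

(* Main.v *)
(* Let [U] be the stable member of the chain [C_+^n M], so that [U = C_+ U], and  *)
(* let [eta] be a generic point of [Supp U]. It suffices to find one [c] outside *)
(* [eta] such that [c U <= N] for all candidates [N] at once: the intersection   *)
(* of all candidates is then a candidate.                                        *)
(*                                                                               *)
(* Let [T <= U] be the set of [u] such that one [c u] lies in all candidates. If *)
(* [phi] has positive degree and is nondegenerate on a quotient [U / Z] at [eta] *)
(* (no nonzero [v] has [phi (R v) = 0]), then comparing dimensions over          *)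
(* [K = k(eta)] and [K^q] shows that [F_* (U / Z) -> Hom (F_* R, U / Z)] is      *)
(* generically onto. Hence the annihilator [J] of [U / (N + Z)] satisfies        *)
(* [g J <= J^[q] + eta] with [g] outside [eta] independent of [N], so [g^3] is   *)
(* in [J]. This gives [phi (U) <= T] as soon as the kernel of [phi], in the      *)
(* above sense, is the kernel of some [phi psi phi]; by noetherianity every      *)
(* [phi] of positive degree is thus nilpotent modulo [T]. Finally, as in         *)
(* Levitzki's theorem, an operator with maximal kernel on a simple quotient of   *)
(* [U / T] satisfies [phi psi phi = 0] for all [psi], hence is zero; as          *)
(* [U = C_+ U], this forces [T = U].                                             *)
From HB Require Import structures.
Require Import Defs.
From mathcomp Require Import all_boot all_algebra.
From mathcomp Require Import ring_quotient boolp classical_sets ring.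

Set Implicit Arguments.
Unset Strict Implicit.
Unset Printing Implicit Defensive.

Import GRing.Theory.

Local Open Scope classical_set_scope.
Local Open Scope ring_scope.

(** * Submodules and noetherian modules *)

(** The intersection of all candidates is the test module as soon as, for each generic point [eta]
    of the support of the stable submodule [U], a single [c] outside [eta] satisfies [c U <= N] for
    every candidate [N] ([uniform_test_candidate]). Each [N] has such an element of its own; the
    work lies in removing the dependence on [N]. Both parts of the theorem are read off from
    [test_module_exists_always].

    At [eta] the module [U] is killed by [eta] ([generic_point_nilpotent], [F_pure_reduced]), hence
    is a finite-dimensional space over the residue field [K]. Let [alpha] have degree [e >= 1] and
    be nondegenerate on a quotient [U / Z]. The injection of [F_* (U / Z)] into [Hom (F_* R, U / Z)]
    sending [v] to [x |-> alpha (x v)] links spaces that generically have the same dimension, so it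
    is generically onto ([generic_duality]). Therefore, if [x] kills [U / (N + Z)], so do its
    coordinates in a generic basis of [F_* R], up to a fixed factor. The annihilator [J] thus
    satisfies [g J <= J J + eta]; as [J] is not inside [eta], an elimination in the style of
    Nakayama gives a power of [g] in [J] ([power_in_ideal]), and duality again lowers the exponent
    to 3 for all [N] ([generic_containment]).

    Nondegeneracy is arranged by noncommutative ring theory. Let [T] consist of the elements having
    a denominator common to all candidates. An operator whose kernel modulo [T] does not grow in
    some [phi psi phi] maps into [T] ([recurrent_sub]), so operators of positive degree are
    nilpotent modulo [T] ([operators_nil]). An argument as for Levitzki's theorem then contradicts
    [F]-purity unless [T = U] ([uniform_denominator]).

    That [U] is [F]-pure rests on the stationarity of the chain [C_+^n M] ([chain_stationary]),
    proved by localizing at a minimal prime of the stable colon ideal. *)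

Section Submodules.
Variables (R : pzRingType) (V : lmodType R).
Implicit Types (X Y : set V) (u v : V) (s : seq V).

Lemma submoduleP X :
  submodule X <-> X 0 /\ forall a u v, X u -> X v -> X (a *: u + v).
Proof.
split=> [[X0 XD]|[X0 XD]].
  split=> [|a u v Xu Xv]; first by move: X0; rewrite !inE.
  have /= := XD a u v; rewrite !inE; exact.
split; first by rewrite !inE.
by move=> a u v /=; rewrite !inE; exact: XD.
Qed.

Section Closure.
Variables (X : set V) (sX : submodule X).

Lemma smod0 : X 0. Proof. by have /submoduleP[] := sX. Qed.

Lemma smodD u v : X u -> X v -> X (u + v).
Proof. by have /submoduleP[_ h] := sX => Xu /(h 1 _ _ Xu); rewrite scale1r. Qed.

Lemma smodZ a u : X u -> X (a *: u).
Proof. by have /submoduleP[X0 h] := sX => /(h a _ 0) /(_ X0); rewrite addr0. Qed.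

Lemma smodN u : X u -> X (- u).
Proof. by move=> /(smodZ (-1)); rewrite scaleN1r. Qed.

Lemma smodB u v : X u -> X v -> X (u - v).
Proof. by move=> Xu /smodN; exact: smodD. Qed.

Lemma smod_subl u v : X v -> X (u + v) -> X u.
Proof. by move=> Xv /smodB/(_ Xv); rewrite addrK. Qed.

Lemma smod_sub u v : X (u - v) -> X v -> X u.
Proof. by move=> /smodD h /h; rewrite subrK. Qed.

Lemma smod_sum (I : Type) (r : seq I) (F : I -> V) :
  (forall i, X (F i)) -> X (\sum_(i <- r) F i).
Proof. by move=> XF; elim/big_ind: _ => //; [exact: smod0|exact: smodD]. Qed.

End Closure.

Lemma submoduleI X Y : submodule X -> submodule Y -> submodule (X `&` Y).
Proof.
move=> sX sY; apply/submoduleP; split; first by split; exact: smod0.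
by move=> a u v [Xu Yu] [Xv Yv]; split; apply: smodD => //; apply: smodZ.
Qed.

Lemma submodule_set0 : submodule [set 0 : V].
Proof.
by apply/submoduleP; split=> // a u v -> ->; rewrite scaler0 addr0.
Qed.

Definition smod_add X Y : set V := [set v | exists u w, [/\ X u, Y w & v = u + w]].

Lemma submodule_add X Y : submodule X -> submodule Y -> submodule (smod_add X Y).
Proof.
move=> sX sY; apply/submoduleP; split.
  by exists 0, 0; split; [exact: smod0|exact: smod0|rewrite addr0].
move=> a _ _ [x [y [Xx Yy ->]]] [x' [y' [Xx' Yy' ->]]].
exists (a *: x + x'), (a *: y + y'); split.
- by apply: smodD => //; exact: smodZ.
- by apply: smodD => //; exact: smodZ.
- by rewrite scalerDr addrACA.
Qed.

(* For a submodule [Z], the submodule generated by [Z] and [s]. *)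
Definition zspan (Z : set V) s : set V :=
  foldr (fun a X => [set v | exists r, X (v - r *: a)]) Z s.

Lemma submodule_zspan Z s : submodule Z -> submodule (zspan Z s).
Proof.
move=> sZ; elim: s => //= a s IH; apply/submoduleP; split.
  by exists 0; rewrite scale0r subr0; exact: smod0.
move=> c u v [r hu] [r' hv]; exists (c * r + r').
have -> : c *: u + v - (c * r + r') *: a
    = c *: (u - r *: a) + (v - r' *: a).
  by rewrite scalerBr scalerDl scalerA opprD addrACA.
by apply: smodD => //; exact: smodZ.
Qed.

Lemma submodule_zspan0 s : submodule (zspan [set 0] s).
Proof. exact: submodule_zspan submodule_set0. Qed.

Lemma zspan_base Z s : Z `<=` zspan Z s.
Proof.
move=> v Zv; elim: s => //= a s IH.
by exists 0; rewrite scale0r subr0.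
Qed.

Lemma mem_zspan Z s a : submodule Z -> a \in s -> zspan Z s a.
Proof.
move=> sZ; elim: s => //= b s IH; rewrite inE => /orP[/eqP->|/IH h].
  by exists 1; rewrite scale1r subrr; apply: smod0; exact: submodule_zspan.
by exists 0; rewrite scale0r subr0.
Qed.

Lemma zspan_sub Z s Y : submodule Y -> Z `<=` Y ->
  (forall a, a \in s -> Y a) -> zspan Z s `<=` Y.
Proof.
move=> sY ZY; elim: s => //= b s IH h v [r /IH hv].
apply: (smod_sub sY (hv _)).
  by move=> a sa; apply: h; rewrite inE sa orbT.
by apply: smodZ => //; apply: h; rewrite mem_head.
Qed.

Lemma smallest_zspan s : smallest (@submodule R V) [set` s] = zspan [set 0] s.
Proof.
rewrite eqEsubset; split=> v.
  move=> h; apply: h; split.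
    exact: submodule_zspan0.
  by move=> a /= sa; exact: mem_zspan submodule_set0 sa.
move=> hv Y [sY hY]; apply: (zspan_sub sY _ _ hv).
  by move=> _ ->; exact: smod0.
by move=> a sa; exact: hY.
Qed.

Lemma submodule_smallest G : submodule (smallest (@submodule R V) G).
Proof.
apply/submoduleP; split; first by move=> Y [sY _]; exact: smod0.
move=> a u v hu hv Y [sY GY]; apply: smodD => //; last exact: hv.
by apply: smodZ => //; exact: hu.
Qed.

Lemma smallest_sub G Y : submodule Y -> G `<=` Y ->
  smallest (@submodule R V) G `<=` Y.
Proof. by move=> sY GY v; apply. Qed.

Lemma fg_zspan X : finitely_generated X <-> exists s, X = zspan [set 0] s.
Proof. by split=> -[s ->]; exists s; rewrite smallest_zspan. Qed.

End Submodules.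

Section Noetherian.
Variables (R : comNzRingType) (noethR : noetherian_ring R).

(** Induction on [s]: the coefficients of [a] occurring in [X] form an ideal [I]. Lifts to [X] of
    generators of [I], together with generators of the part of [X] inside the span of the tail,
    generate [X]. *)
Lemma noetherian_zspan (V : lmodType R) (s : seq V) (X : set V) :
  submodule X -> X `<=` zspan [set 0] s -> finitely_generated X.
Proof.
move=> + Xs; rewrite fg_zspan.
elim: s X Xs => [|a s IH] X Xs sX.
  exists [::]; rewrite eqEsubset; split=> //= v ->; exact: smod0.
pose I : set R^o := [set r | exists2 y, zspan [set 0] s y & X (r *: a + y)].
have sI : submodule I.
  apply/submoduleP; split.
    exists 0; first exact: smod0 (submodule_zspan0 _).
    by rewrite scale0r addr0; exact: smod0.
  move=> c r r' [y hy Xy] [y' hy' Xy']; exists (c *: y + y').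
    have sS := submodule_zspan0 s.
    by apply: smodD => //; exact: smodZ.
  have -> : (c *: r + r') *: a + (c *: y + y')
     = c *: ((r : R) *: a + y) + ((r' : R) *: a + y').
    by rewrite scalerDr scalerA addrACA scalerDl.
  by apply: smodD => //; exact: smodZ.
have [t It] := (fg_zspan _).1 (noethR sI).
have sXs : submodule (X `&` zspan [set 0] s).
  by apply: submoduleI => //; exact: submodule_zspan0.
have [s' Xs'] := IH _ (@subIsetr _ _ _) sXs.
have [f fP] : exists f : R^o -> V, forall r, I r ->
    zspan [set 0] s (f r) /\ X ((r : R) *: a + f r).
  have h r : exists y, I r -> zspan [set 0] s y /\ X ((r : R) *: a + y).
    by case: (pselect (I r)) => [[y ? ?]|?]; [exists y|exists 0].
  by have [f fP] := choice h; exists f.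
exists ([seq (r : R) *: a + f r | r <- t] ++ s').
have sS := submodule_zspan0 ([seq (r : R) *: a + f r | r <- t] ++ s').
have It' r : r \in t -> I r.
  by move=> rt; rewrite It; exact: mem_zspan (submodule_set0 _) rt.
rewrite eqEsubset; split=> v; last first.
  apply: zspan_sub => //; first by move=> _ ->; exact: smod0.
  move=> b; rewrite mem_cat => /orP[/mapP[r rt ->]|bs'].
    by have [] := fP _ (It' _ rt).
  have : zspan [set 0] s' b by exact: mem_zspan (submodule_set0 V) bs'.
  by rewrite -Xs' => -[].
move=> Xv; have [r hr] := Xs _ Xv.
have : I r by exists (v - r *: a); rewrite // addrC subrK.
rewrite {1}It => rt.
have [y hy [hy' Xy]] : exists2 y, zspan [set 0] s y &
    zspan [set 0] ([seq (r : R) *: a + f r | r <- t] ++ s') (r *: a + y)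
    /\ X (r *: a + y).
  move: r rt {hr}; pose J : set R^o := [set r | exists2 y, zspan [set 0] s y &
    zspan [set 0] ([seq (r : R) *: a + f r | r <- t] ++ s') ((r : R) *: a + y)
    /\ X ((r : R) *: a + y)].
  change (zspan [set 0] t `<=` J); apply: zspan_sub.
  - apply/submoduleP; split.
      exists 0; first exact: smod0 (submodule_zspan0 _).
      by rewrite scale0r addr0; split; exact: smod0.
    move=> c r r' [y hy [Xy Xy2]] [y' hy' [Xy' Xy2']]; exists (c *: y + y').
      have sS2 := submodule_zspan0 s.
      by apply: smodD => //; exact: smodZ.
    have -> : (c *: r + r') *: a + (c *: y + y')
       = c *: ((r : R) *: a + y) + ((r' : R) *: a + y').
      by rewrite scalerDr scalerA addrACA scalerDl.
    by split; apply: smodD => //; exact: smodZ.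
  - move=> _ ->; exists 0; first exact: smod0 (submodule_zspan0 _).
    by rewrite scale0r addr0; split; exact: smod0.
  - move=> r rt; have [h1 h2] := fP _ (It' _ rt); exists (f r) => //; split=> //.
    apply: mem_zspan (submodule_set0 V) _.
    by rewrite mem_cat; apply/orP; left; apply/mapP; exists r.
have : (X `&` zspan [set 0] s) (v - (r *: a + y)).
  split; first exact: smodB.
  have sS2 := submodule_zspan0 s.
  by rewrite opprD addrA; exact: smodB.
rewrite Xs' => hv; apply: (smod_sub sS _ hy').
apply: (zspan_sub sS _ _ hv); first by move=> _ ->; exact: smod0.
by move=> b bs; apply: mem_zspan (submodule_set0 V) _; rewrite mem_cat bs orbT.
Qed.

Section NoetherianModule.
Variables (V : lmodType R) (fgV : finitely_generated [set: V]).

Lemma fg_submodule (X : set V) : submodule X -> finitely_generated X.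
Proof.
have [s Vs] := (fg_zspan _).1 fgV.
by move=> sX; apply: (noetherian_zspan (s := s)) => // v _; rewrite -Vs.
Qed.

Lemma ascending_stationary (X : nat -> set V) :
  (forall n, submodule (X n)) -> (forall n, X n `<=` X n.+1) ->
  exists n0, forall n, (n0 <= n)%N -> X n = X n0.
Proof.
move=> sX incX.
have mono m n : (m <= n)%N -> X m `<=` X n.
  move=> /subnK <-; elim: (n - m)%N => [|k IH] //.
  by apply: subset_trans IH _; rewrite addSn.
pose Y := \bigcup_n X n.
have sY : submodule Y.
  apply/submoduleP; split; first by exists 0%N => //; exact: smod0.
  move=> a u v [m _ mu] [n _ nv]; exists (maxn m n) => //.
  apply: smodD => //; last exact: (mono _ _ (leq_maxr m n)).
  by apply: smodZ => //; exact: (mono _ _ (leq_maxl m n)).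
have [s Ys] := (fg_zspan _).1 (fg_submodule sY).
have [n0 hn0] : exists n0, forall a, a \in s -> X n0 a.
  have : forall a, a \in s -> Y a.
    by move=> a sa; rewrite Ys; exact: mem_zspan (submodule_set0 V) sa.
  elim: s {Ys} => [|a s IH] h; first by exists 0%N.
  have [b bs|n0 hn0] := IH; first by apply: h; rewrite inE bs orbT.
  have [n1 _ hn1] := h a (mem_head _ _).
  exists (maxn n0 n1) => b; rewrite inE => /orP[/eqP->|bs].
    by apply: (mono _ _ (leq_maxr n0 n1)).
  by apply: (mono _ _ (leq_maxl n0 n1)); exact: hn0.
exists n0 => n n0n; rewrite eqEsubset; split; last exact: mono.
move=> v nv; have : Y v by exists n.
rewrite Ys; apply: zspan_sub => // _ ->; exact: smod0.
Qed.

Lemma noetherian_max (F : set (set V)) X0 :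
  (forall X, F X -> submodule X) -> F X0 ->
  exists2 X, F X & forall Y, F Y -> X `<=` Y -> Y = X.
Proof.
move=> sF FX0; apply: contrapT => nomax.
have next X : exists Y, F X -> [/\ F Y, X `<=` Y & Y <> X].
  case: (pselect (F X)) => [FX|?]; last by exists X.
  apply: contrapT => h; apply: nomax; exists X => // Y FY XY.
  by apply: contrapT => YX; apply: h; exists Y.
have [f fP] := choice next.
pose X n := iter n f X0.
have FX n : F (X n) by elim: n => //= n /fP[].
have [//|n|n0 /(_ n0.+1 (leqnSn _))] := @ascending_stationary X.
- by move=> n; exact: sF.
- by have [] := fP _ (FX n).
- by have [_ _] := fP _ (FX n0).
Qed.

End NoetherianModule.
End Noetherian.

(** * Linear algebra at a prime *)

Arguments restrict : simpl never.

Section Primes.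
Variables (R : comNzRingType) (P : spec R).
Implicit Types (r s t x : R).

Lemma spec0 : 0 \in P. Proof. by have [] := spec_ideal P. Qed.

Lemma specD x y : x \in P -> y \in P -> x + y \in P.
Proof.
by have [_ _ h] := spec_ideal P => xP yP; have := h 1 x y xP yP; rewrite mul1r.
Qed.

Lemma specM r x : x \in P -> r * x \in P.
Proof.
have [h0 _ h] := spec_ideal P => xP.
by have := h r x 0 xP h0; rewrite addr0.
Qed.

Lemma spec1 : 1 \notin P. Proof. exact: one_notin_prime. Qed.

Lemma specNM s t : s \notin P -> t \notin P -> s * t \notin P.
Proof. by move=> sP tP; rewrite (prime_idealrM (spec_pred P)) negb_or sP. Qed.

Lemma specNX s n : s \notin P -> s ^+ n \notin P.
Proof.
move=> sP; elim: n => [|n IH]; first exact: spec1.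
by rewrite exprS; exact: specNM.
Qed.

Lemma specX s n : (0 < n)%N -> s \in P -> s ^+ n \in P.
Proof. by case: n => // n _ sP; rewrite exprSr; exact: specM. Qed.

(** The product of the denominators of finitely many generators works for all of [X]. This is how
    local statements at [P] become global ones. *)
Lemma fg_uniform (V : lmodType R) (X Y : set V) :
  finitely_generated X -> submodule Y ->
  (forall v, X v -> exists2 c, c \notin P & Y (c *: v)) ->
  exists2 c, c \notin P & forall v, X v -> Y (c *: v).
Proof.
move=> /fg_zspan[s ->] sY h.
have [c cP hc] : exists2 c, c \notin P & forall a, a \in s -> Y (c *: a).
  have : forall a, a \in s -> exists2 c, c \notin P & Y (c *: a).
    by move=> a sa; apply: h; exact: mem_zspan (submodule_set0 V) sa.
  elim: s {h} => [|a s IH] h; first by exists 1 => //; exact: spec1.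
  have [b bs|c cP hc] := IH; first by apply: h; rewrite inE bs orbT.
  have [d dP hd] := h a (mem_head _ _).
  exists (c * d) => [|b]; first exact: specNM.
  rewrite inE => /orP[/eqP->|/hc hb]; first by rewrite -scalerA; exact: smodZ.
  by rewrite mulrC -scalerA; exact: smodZ.
exists c => // v; pose Z : set V := [set v | Y (c *: v)].
change (zspan [set 0] s v -> Z v); apply: zspan_sub => //.
  apply/submoduleP; split; first by rewrite /Z /= scaler0; exact: smod0.
  move=> a u w hu hw; rewrite /Z /= scalerDr scalerA mulrC -scalerA.
  by apply: smodD => //; exact: smodZ.
by move=> _ ->; rewrite /Z /= scaler0; exact: smod0.
Qed.

Section GenericSpan.
Variables (V : lmodType R) (Z : set V) (sZ : submodule Z).
Hypothesis PZ : forall x v, x \in P -> Z (x *: v).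
Implicit Types (S B : seq V).

(* The preimage in [V] of the [k(P)]-span of [S] in the localization of [V / Z]. *)
Definition cl S : set V := [set v | exists2 t, t \notin P & zspan Z S (t *: v)].

Fixpoint independent S : Prop :=
  if S is a :: S' then ~ cl S' a /\ independent S' else True.

Lemma submodule_cl S : submodule (cl S).
Proof.
have sS := submodule_zspan S sZ; apply/submoduleP; split.
  by exists 1; [exact: spec1|rewrite scaler0; exact: smod0].
move=> a u v [s sP hs] [t tP ht]; exists (s * t); first exact: specNM.
have -> : (s * t) *: (a *: u + v) = (t * a) *: (s *: u) + s *: (t *: v).
  by rewrite scalerDr !scalerA; congr (_ *: _ + _); ring.
by apply: smodD => //; exact: smodZ.
Qed.

Lemma cl_sat S s v : s \notin P -> cl S (s *: v) -> cl S v.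
Proof.
by move=> sP [t tP]; rewrite scalerA; exists (t * s) => //; exact: specNM.
Qed.

Lemma zspan_cl S : zspan Z S `<=` cl S.
Proof. by move=> v hv; exists 1; [exact: spec1|rewrite scale1r]. Qed.

Lemma mem_cl S a : a \in S -> cl S a.
Proof. by move=> /(mem_zspan sZ)/zspan_cl. Qed.

Lemma cl_trans S S' : (forall a, a \in S -> cl S' a) -> cl S `<=` cl S'.
Proof.
move=> h v [t tP] /(zspan_sub (submodule_cl S')) hv.
by apply: (cl_sat tP); apply: hv => // u /(zspan_base S')/zspan_cl.
Qed.

(** The coefficient of [a] lies outside [P], hence is invertible in the residue field; otherwise
    [PZ] would absorb its term into [Z]. *)
Lemma cl_exchange S a b : cl (a :: S) b -> ~ cl S b -> cl (b :: S) a.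
Proof.
move=> [t tP [r hr]] nx; have sS := submodule_zspan S sZ.
have rP : r \notin P.
  apply/negP => rP; apply: nx; exists t => //.
  by apply: (smod_sub sS hr); apply/zspan_base/PZ.
exists r => //; exists t.
by rewrite -opprB; exact: smodN.
Qed.

Lemma cl_first_dep S B b : cl (S ++ B) b -> ~ cl B b ->
  exists S1 a S2, S = S1 ++ a :: S2 /\ cl (b :: S2 ++ B) a.
Proof.
move=> + nb; elim: S => //= a S IH hb.
have [/IH[S1 [a' [S2 [-> h]]]]|h] := pselect (cl (S ++ B) b).
  by exists (a :: S1), a', S2.
by exists [::], a, S; split=> //; exact: cl_exchange.
Qed.

Lemma steinitz_replace B S : independent B -> (forall b, b \in B -> cl S b) ->
  exists S', (size S' + size B)%N = size S /\ forall a, a \in S -> cl (S' ++ B) a.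
Proof.
elim: B => [_ _|b B IH /= [nb iB] hB].
  by exists S; rewrite addn0 cats0; split=> // a /mem_cl.
have [|S' [szS' hS']] := IH iB.
  by move=> c cB; apply: hB; rewrite inE cB orbT.
have hb : cl (S' ++ B) b by apply: (cl_trans hS'); apply: hB; exact: mem_head.
have [S1 [a [S2 [eS' ha]]]] := cl_first_dep hb nb.
exists (S1 ++ S2); split.
  by rewrite -szS' eS' !size_cat /= addnS !addnS addSn.
move=> c /hS'; apply: cl_trans => {}c.
rewrite eS' mem_cat mem_cat inE -!orbA => /or4P[h|/eqP->|h|h].
- by apply: mem_cl; rewrite !mem_cat h.
- apply: cl_trans ha => d; rewrite inE mem_cat => /or3P[/eqP->|h|h];
  by apply: mem_cl; rewrite !mem_cat !inE ?eqxx ?h ?orbT.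
- by apply: mem_cl; rewrite !mem_cat h orbT.
- by apply: mem_cl; rewrite !mem_cat inE h !orbT.
Qed.

Lemma steinitz B S : independent B -> (forall b, b \in B -> cl S b) ->
  (size S <= size B)%N -> forall a, a \in S -> cl B a.
Proof.
move=> iB hB szSB; have [S' [szS' hS']] := steinitz_replace iB hB.
suff S'0 : S' = [::] by rewrite S'0 in hS'.
apply/nilP; rewrite /nilp -leqn0 -(leq_add2r (size B)) szS'.
by rewrite add0n.
Qed.

Lemma basis_exists S :
  exists B, independent B /\ forall a, a \in S -> cl B a.
Proof.
elim: S => [|a S [B [iB hB]]]; first by exists [::].
have [ha|ha] := pselect (cl B a).
  by exists B; split=> // b; rewrite inE => /orP[/eqP->|/hB].
exists (a :: B); split=> // b; rewrite inE => /orP[/eqP->|/hB hb].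
  by apply: mem_cl; exact: mem_head.
by apply: cl_trans hb => c cB; apply: mem_cl; rewrite inE cB orbT.
Qed.

Lemma basis_of_fg : finitely_generated [set: V] ->
  exists B, independent B /\ forall v, cl B v.
Proof.
move=> /fg_zspan[S VS]; have [B [iB hB]] := basis_exists S.
exists B; split=> // v; have : zspan [set 0] S v by rewrite -VS.
apply: zspan_sub => //; first exact: submodule_cl.
by move=> _ ->; exact: smod0 (submodule_cl _).
Qed.

Lemma zspan_coef S v : zspan Z S v ->
  exists y : nat -> R, Z (v - \sum_(i < size S) y i *: S`_i).
Proof.
elim: S v => [|a S IH] v /=; first by exists (fun=> 0); rewrite big_ord0 subr0.
move=> [r /IH[y hy]]; exists (fun i => if i is j.+1 then y j else r).
by rewrite big_ord_recl /= opprD addrA.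
Qed.

End GenericSpan.

Lemma cl_preim (V W : lmodType R) (f : V -> W) (Z : set V) (Z' : set W) S v :
  (forall r u w, f (r *: u + w) = r *: f u + f w) ->
  (forall u, Z' (f u) -> Z u) -> cl Z' (map f S) (f v) -> cl Z S v.
Proof.
move=> lf hZ [t tP]; have f0 : f 0 = 0.
  by have := lf (-1) 0 0; rewrite scaler0 addr0 scaleN1r addNr.
have -> : t *: f v = f (t *: v) by have := lf t v 0; rewrite f0 !addr0.
move=> h; exists t => //; elim: S (t *: v) h => [|a S IH] u /=; first exact: hZ.
move=> [r hr]; exists r; apply: IH.
suff -> : f (u - r *: a) = f u - r *: f a by [].
by rewrite addrC -scaleNr lf scaleNr addrC.
Qed.

Lemma independent_map (V W : lmodType R) (f : V -> W) (Z : set V) (Z' : set W) S :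
  (forall r u w, f (r *: u + w) = r *: f u + f w) ->
  (forall u, Z' (f u) -> Z u) -> independent Z S -> independent Z' (map f S).
Proof.
move=> lf hZ; elim: S => //= a S IH [na /IH iS]; split=> //.
by move=> /(cl_preim lf hZ).
Qed.

(** * Independence after restriction of scalars along Frobenius *)

Section RestrictedScalars.
Variables (F : {rmorphism R -> R}) (W : lmodType R) (Z : set W).

Let PF : set (restrict F R^o) := [set x | (x : R) \in P].
Let ZF : set (restrict F W) := Z.

Lemma submodule_restrict_spec : submodule PF.
Proof.
apply/submoduleP; split; first exact: spec0.
by move=> a u v uP vP; apply: specD => //; exact: specM.
Qed.

Definition prods (L : seq (restrict F R^o)) (B : seq W) : seq (restrict F W) :=
  [seq ((l : R) *: b : W) | b <- B, l <- L].

Lemma zspan_restrict_cat (L : seq (restrict F R^o)) (b : W)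
    (S : seq (restrict F W)) v :
  zspan ZF ([seq ((l : R) *: b : W) | l <- L] ++ S) v ->
  exists2 x : restrict F R^o, zspan [set 0] L x &
    zspan ZF S (v - ((x : R) *: b : W)).
Proof.
elim: L v => [|l L IH] v /=; first by exists 0; rewrite ?scale0r ?subr0.
move=> [r /IH[x hx hv]]; exists (F r * l + x).
  exists r.
  have -> : (F r * l + x : restrict F R^o) - r *: (l : restrict F R^o) = x.
    by rewrite addrC; exact: (addKr (F r * l : R)).
  exact: hx.
suff <- : v - r *: (l *: b : restrict F W) - (x *: b : W)
  = v - ((F r * l + x) *: b : W) :> restrict F W by [].
by rewrite scalerDl opprD addrA -scalerA.
Qed.

Lemma zspan_prods (L : seq (restrict F R^o)) (B : seq W) :
  zspan ZF (prods L B) `<=` zspan Z B.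
Proof.
elim: B => //= b B IH v /zspan_restrict_cat[x _ /IH hv].
by exists x.
Qed.

(** The tower law: in a relation among the products, the coefficient of each [b] is a combination of
    [L]. It lies in [P] by independence of [B], and independence of [L] then applies. *)
Lemma independent_prods (L : seq (restrict F R^o)) (B : seq W) :
  independent PF L -> independent Z B -> independent ZF (prods L B).
Proof.
move=> iL; elim: B => //= b B IH [nb /IH iB]; rewrite /prods /=.

suff: forall L' : seq (restrict F R^o), independent PF L' ->
    independent ZF ([seq ((l : R) *: b : W) | l <- L'] ++ prods L B) by apply.
elim=> //= l L' IHL [nl /IHL iL']; split=> // -[t tP].
move=> /zspan_restrict_cat[x hx /zspan_prods hb].
have [h|h] := boolP (F t * l - x \in P); last first.
  apply: nb; exists (F t * l - x) => //.
  by rewrite scalerBl -scalerA.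
apply: nl; exists t => //.
have sL := submodule_zspan L' submodule_restrict_spec.
apply: (smod_sub sL (v := x)); first exact: zspan_base.
apply: (zspan_sub sL _ _ hx); first by move=> _ ->; exact: smod0.
by move=> a aL; exact: mem_zspan submodule_restrict_spec aL.
Qed.

End RestrictedScalars.
End Primes.

Local Open Scope ring_scope.
(** * Frobenius duality at a prime *)

Section GenericDuality.
Variables (R : comNzRingType) (P : spec R) (F : {rmorphism R -> R}).
Hypotheses (finF : finite_ring_map F) (FP : forall t, (F t \in P) = (t \in P)).
Variables (W : lmodType R) (Z : set W).
Hypotheses (fgW : finitely_generated [set: W]) (sZ : submodule Z).
Hypothesis PZ : forall x v, x \in P -> Z (x *: v).
Hypothesis Zsat : forall s v, s \notin P -> Z (s *: v) -> Z v.
Variable alpha : W -> W.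
Hypothesis alphaD : forall u v, alpha (u + v) = alpha u + alpha v.
Hypothesis alphaZ : forall r v, alpha (F r *: v) = r *: alpha v.
Hypothesis alpha_stable : forall v, Z v -> Z (alpha v).
Hypothesis alpha_inj : forall v, (forall r, Z (alpha (r *: v))) -> Z v.

Let PF : set (restrict F R^o) := [set x | (x : R) \in P].
Let ZF : set (restrict F W) := Z.

Let sPF : submodule PF := submodule_restrict_spec P F.

Let alpha0 : alpha 0 = 0.
Proof. by have := alphaZ 0 0; rewrite scaler0 scale0r. Qed.

Let alpha_sum (I : Type) (r : seq I) (G : I -> W) :
  alpha (\sum_(i <- r) G i) = \sum_(i <- r) alpha (G i).
Proof. exact: (big_morph alpha alphaD alpha0). Qed.

Lemma generic_frobenius_basis : exists (L : seq (restrict F R^o)) t,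
  [/\ t \notin P, independent P PF L & forall x, zspan PF L (t *: x)].
Proof.
have [L [iL hL]] := basis_of_fg P sPF finF.
have [t tP ht] := fg_uniform finF (submodule_zspan L sPF) (fun v _ => hL v).
by exists L, t; split=> // x; exact: ht.
Qed.

Section Pairing.
Variables (L : seq (restrict F R^o)) (t : R) (tP : t \notin P).
Hypothesis hL : forall x, zspan PF L (t *: x).
Let m := size L.

(** The map from [F_* W] to [Hom (F_* R, W)] induced by [alpha], a homomorphism being recorded by
    its values on the generic basis [L]. *)
Let f (v : restrict F W) : {ffun 'I_m -> W} :=
  [ffun i : 'I_m => alpha ((L`_i : R) *: (v : W))].
Let Z' : set {ffun 'I_m -> W} := [set g | forall i, Z (g i)].

Let f_lin r u w : f (r *: u + w) = r *: f u + f w.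
Proof.
apply/ffunP => i; rewrite !ffunE.
have -> : (r *: u + w : restrict F W) = F r *: (u : W) + (w : W) by [].
rewrite scalerDr scalerA mulrC -scalerA alphaD alphaZ //.
Qed.

Let f_inj v : Z' (f v) -> ZF v.
Proof.
move=> hv; apply: alpha_inj => r.
pose X : set (restrict F R^o) := [set x | Z (alpha ((x : R) *: (v : W)))].
have sX : submodule X.
  apply/submoduleP; split; first by rewrite /X /= scale0r alpha0; exact: smod0.
  move=> a x y hx hy; rewrite /X /=.
  have -> : (a *: x + y : restrict F R^o) = F a * (x : R) + (y : R) by [].
  by rewrite scalerDl -scalerA alphaD alphaZ; apply: smodD => //; exact: smodZ.
have : X (t *: (r : restrict F R^o)).
  apply: (zspan_sub sX _ _ (hL r)).
    by move=> x xP; apply: alpha_stable; exact: PZ.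
  move=> l /(nthP 0)[i iL <-]; have := hv (Ordinal iL).
  by rewrite ffunE.
rewrite /X /=; have -> : (t *: (r : restrict F R^o)) = F t * r by [].
by rewrite -scalerA alphaZ; exact: Zsat.
Qed.

Let sZ' : submodule Z'.
Proof.
apply/submoduleP; split=> [i|a u v hu hv i]; rewrite !ffunE; first exact: smod0.
by apply: smodD => //; exact: smodZ.
Qed.

Let PZ' (x : R) (g : {ffun 'I_m -> W}) : x \in P -> Z' (x *: g).
Proof. by move=> xP i; rewrite ffunE; exact: PZ. Qed.

Let single (i : 'I_m) (v : W) : {ffun 'I_m -> W} :=
  [ffun j => if j == i then v else 0].

Let single_lin i r u w : single i (r *: u + w) = r *: single i u + single i w.
Proof.
by apply/ffunP => j; rewrite !ffunE; case: ifP => // _; rewrite scaler0 addr0.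
Qed.

Let single0 i : single i 0 = 0.
Proof. by apply/ffunP => j; rewrite !ffunE if_same. Qed.

Let f0 : f 0 = 0.
Proof. by apply/ffunP => j; rewrite !ffunE scaler0 alpha0. Qed.

(** A dimension count: with [B] a basis of [W / Z] at [P], the images of the [size L * size B]
    products are independent by [f_inj], and a family [S] of the same size spans the target.
    Steinitz then makes the images span. *)
Lemma pairing_surjective : independent P PF L ->
  exists2 s, s \notin P & forall i v, exists w, Z' (single i (s *: v) - f w).
Proof.
move=> iL; have [B [iB hB]] := basis_of_fg P sZ fgW.
pose A := prods L B; pose S := [seq single i b | b <- B, i <- enum 'I_m].
have iA : independent P Z' (map f A).
  have iA := independent_prods iL iB.
  by have := independent_map f_lin f_inj iA.
have cS i v : cl P Z' S (single i v).
  have sC := submodule_cl P sZ' S.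
  pose X : set W := [set u | cl P Z' S (single i u)].
  have [c cP hc] := hB v; suff Xcv : X (c *: v).
    move: Xcv; rewrite /X /=.
    have -> : single i (c *: v) = c *: single i v.
      by have := single_lin i c v 0; rewrite single0 !addr0.
    exact: cl_sat.
  apply: (zspan_sub _ _ _ hc).
  - apply/submoduleP; split.
      by rewrite /X /= single0; exact: smod0.
    move=> r u w hu hw; rewrite /X /= single_lin; apply: smodD => //.
    exact: smodZ.
  - move=> u Zu; apply/zspan_cl/zspan_base => j; rewrite ffunE.
    by case: ifP => // _; exact: smod0.
  - move=> b bB; apply: mem_cl => //; apply/allpairsP; exists (b, i).
    by rewrite mem_enum.
have hS g : cl P Z' S g.
  have -> : g = \sum_i single i (g i).
    apply/ffunP => j; rewrite sum_ffunE (bigD1 j) //= !ffunE eqxx big1 ?addr0 //.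
    by move=> k kj; rewrite ffunE eq_sym (negPf kj).
  by apply: (smod_sum (submodule_cl P sZ' S)) => i; exact: cS.
have szS : (size S <= size (map f A))%N.
  by rewrite size_map !size_allpairs size_enum_ord.
have hA g : cl P Z' (map f A) g.
  apply: (cl_trans sZ' _ (hS g)).
  by apply: (steinitz sZ' PZ' iA _ szS) => b _; exact: hS.
have hf g : zspan Z' (map f A) g -> exists w, Z' (g - f w).
  elim: A {iA hA szS} g => [|a A IH] g /=.
    by move=> hg; exists 0; rewrite f0 subr0.
  move=> [r /IH[w hw]]; exists (r *: a + w).
  by rewrite f_lin opprD addrA.
pose Y i : set W := [set v | exists w, Z' (single i v - f w)].
have sY i : submodule (Y i).
  apply/submoduleP; split.
    by exists 0; rewrite single0 f0 subr0; exact: smod0.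
  move=> a u v [w hw] [w' hw']; exists (a *: w + w').
  rewrite single_lin f_lin opprD addrACA -scalerBr.
  exact: (smodD sZ' (smodZ sZ' a hw) hw').
(* Each coordinate has its own denominator; their product serves all of them. *)
have /choice[c hc] i : exists c, c \notin P /\ forall v, Y i (c *: v).
  have [v _|c cP hc] := fg_uniform (P := P) fgW (sY i).
    have [c cP hv] := hA (single i v); exists c => //.
    have [w hw] := hf _ hv; exists w.
    suff -> : single i (c *: v) = c *: single i v by [].
    by apply/ffunP => j; rewrite !ffunE; case: ifP => //; rewrite scaler0.
  by exists c; split=> // v; exact: hc.
exists (\prod_i c i) => [|i v].
  by elim/big_ind: _ => [||i _]; [exact: spec1|exact: specNM|have [] := hc i].
have [_ hi] := hc i; rewrite (bigD1 i) //= mulrC -scalerA.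
exact: (smodZ (sY i) _ (hi v)).
Qed.

End Pairing.

Lemma generic_duality : exists (L : seq R) t, [/\ t \notin P, (0 < size L)%N,
  forall x, exists y : nat -> R,
    F t * x - \sum_(i < size L) F (y i) * L`_i \in P
  & forall i v, (i < size L)%N -> exists w, forall j, (j < size L)%N ->
    Z ((if j == i then t *: v else 0) - alpha (L`_j *: w))].
Proof.
have [L [t1 [t1P iL hL]]] := generic_frobenius_basis.
have [t2 t2P ht2] := pairing_surjective t1P hL iL.
exists L, (t1 * t2); split; first exact: specNM.
(* An empty basis would put [F t1] in [P]. *)
- case: L iL hL t2P ht2 => // _ /(_ 1) h _ _.
  have : F t1 * 1 \in P := h.
  by rewrite mulr1 FP (negPf t1P).
- move=> x; have : zspan PF L ((t1 * t2) *: (x : restrict F R^o)).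
    by rewrite mulrC -scalerA; apply: smodZ => //; exact: submodule_zspan.
  by move=> /zspan_coef[y hy]; exists y.
- move=> i v iL'; have [w hw] := ht2 (Ordinal iL') (t1 *: v).
  exists w => j jL; have := hw (Ordinal jL); rewrite !ffunE -val_eqE /=.
  by rewrite scalerA mulrC.
Qed.

End GenericDuality.

Local Open Scope ring_scope.

(** * Powers of an element in an ideal, by elimination *)

Section PowerInIdeal.
Variables (R : comNzRingType) (P : spec R) (J : set R^o) (g : R).
Hypotheses (fgJ : finitely_generated J) (sJ : submodule J).
Hypothesis PJ : forall x, x \in P -> J x.
Hypothesis gJ : forall x : R, J x -> exists n (u v : nat -> R),
  [/\ forall i, J (u i), forall i, J (v i)
    & g * x - \sum_(i < n) u i * v i \in P].

Let PR : set R^o := [set x | (x : R) \in P].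

Let sPR : submodule PR.
Proof.
apply/submoduleP; split; first exact: spec0.
by move=> a u v uP vP; apply: specD => //; exact: specM.
Qed.

Let JM (r x : R) : J x -> J (r * x). Proof. exact: (smodZ sJ r). Qed.

(* Nakayama's lemma for [g J <= J J + P], eliminating generators one at a time. *)
Lemma eliminate_generators (s : seq R) (t : R) :
  (forall j, j \in s -> J j) -> (exists a, J (g ^+ a - t)) ->
  (forall x : R, J x -> zspan PR s (t * x : R)) ->
  exists a t', J (g ^+ a - t') /\ forall x : R, J x -> t' * x \in P.
Proof.
elim: s t => [|j s IH] t hs [a ha] ht; first by exists a, t.
have sS : submodule (zspan PR s) by exact: submodule_zspan.
have [|n [u [v [hu hv huv]]]] := gJ (x := j); first by apply: hs; exact: mem_head.
have /choice[r hr] i : exists r, zspan PR s (t * v i - r * j : R).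
  by have [r hr] := ht _ (hv i); exists r.
(* Replacing each [v i] by [r i * j] in [g * j], after multiplication by [t], leaves
   [(g * t - y) * j] in the span of the remaining generators; [y] is in [J] because the [u i]
   are. *)
pose y := \sum_(i < n) u i * r i.
have Jy : J y by apply: (smod_sum sJ) => i; rewrite mulrC; exact: JM.
have hy : zspan PR s ((g * t - y) * j : R).
  have -> : (g * t - y) * j =
      t * (g * j - \sum_(i < n) u i * v i)
      + \sum_(i < n) u i * (t * v i - r i * j).
    have -> : \sum_(i < n) u i * (t * v i - r i * j)
        = t * (\sum_(i < n) u i * v i) - y * j.
      by rewrite mulr_sumr mulr_suml -sumrB; apply: eq_bigr => i _; ring.
    by ring.
  apply: (smodD sS); first by apply: (smodZ sS); exact: zspan_base.
  by apply: (smod_sum sS) => i; exact: (smodZ sS).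
apply: (IH ((g * t - y) * t)) => [k ks||x Jx].
- by apply: hs; rewrite inE ks orbT.
- exists (a + a).+1.
  have -> : g ^+ (a + a).+1 - (g * t - y) * t
      = g * (g ^+ a + t) * (g ^+ a - t) + t * y.
    by rewrite exprS exprD; ring.
  by apply: (smodD sJ); apply: JM.
have [c hc] := ht x Jx.
have -> : (g * t - y) * t * x
    = (g * t - y) * (t * x - c * j) + c * ((g * t - y) * j) by ring.
by apply: (smodD sS); apply: (smodZ sS).
Qed.

(** With all generators eliminated, [t J <= P] for some [t] congruent to a power of [g] modulo [J].
    As [x] is outside [P], [t] lies in [P], hence in [J]. *)
Lemma power_in_ideal x : J x -> x \notin P -> exists a, J (g ^+ a).
Proof.
move=> Jx xP; have [s Js] := (fg_zspan _).1 fgJ.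
have [||y Jy|a [t [ha ht]]] := @eliminate_generators s 1.
- by move=> j js; rewrite Js; exact: (mem_zspan (V := R^o) (submodule_set0 _) js).
- by exists 0; rewrite expr0 subrr; exact: (smod0 sJ).
- rewrite mul1r; move: Jy; rewrite Js; apply: zspan_sub.
  + exact: submodule_zspan.
  + by move=> _ ->; apply: (smod0 (submodule_zspan _ sPR)).
  + by move=> j; exact: mem_zspan.
exists a; have := ht x Jx.
rewrite (prime_idealrM (spec_pred P)) (negPf xP) orbF => /PJ.
exact: (smod_sub sJ ha).
Qed.

End PowerInIdeal.

(** * A multiplier independent of the submodule *)

Section GenericContainment.
Variables (R : comNzRingType) (noethR : noetherian_ring R) (P : spec R).
Variables (F : {rmorphism R -> R}) (q : nat).
Hypotheses (finF : finite_ring_map F) (Fq : forall x, F x = x ^+ q).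
Hypothesis q2 : (2 <= q)%N.
Variables (W : lmodType R) (Z : set W).
Hypotheses (fgW : finitely_generated [set: W]) (sZ : submodule Z).
Hypothesis PZ : forall x v, x \in P -> Z (x *: v).
Hypothesis Zsat : forall s v, s \notin P -> Z (s *: v) -> Z v.
Variable alpha : W -> W.
Hypothesis alphaD : forall u v, alpha (u + v) = alpha u + alpha v.
Hypothesis alphaZ : forall r v, alpha (r ^+ q *: v) = r *: alpha v.
Hypothesis alpha_stable : forall v, Z v -> Z (alpha v).
Hypothesis alpha_inj : forall v, (forall r, Z (alpha (r *: v))) -> Z v.

Lemma generic_containment : exists2 g, g \notin P & forall N : set W,
  submodule N -> Z `<=` N -> (forall v, N v -> N (alpha v)) ->
  (exists2 s, s \notin P & forall v, N (s *: v)) -> forall v, N (g *: v).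
Proof.
have q0 : (0 < q)%N by apply: leq_trans q2.
have FP t : (F t \in P) = (t \in P).
  rewrite Fq; have [tP|tP] := boolP (t \in P); first exact: specX.
  by apply/negbTE; exact: specNX.
have alphaF r v : alpha (F r *: v) = r *: alpha v by rewrite Fq.
have [L [t [tP L0 hL hdual]]] :=
  generic_duality finF FP fgW sZ PZ Zsat alphaD alphaF alpha_stable alpha_inj.
have alpha0 : alpha 0 = 0 by have := alphaF 0 0; rewrite scaler0 scale0r.
have alpha_sum := big_morph alpha alphaD alpha0.
(* One factor [t ^+ q] is [F t], which allows expanding in [L]; the other turns each coordinate
   [y i] into [t * y i], which [Jcoef] places in [J]. *)
pose g := (t * t) ^+ q; have gP : g \notin P by apply/specNX/specNM.
(* Exponent 3: [g ^ a] in [J] gives [g ^ (uphalf a + 1)] in [J], cf. [reduce]. *)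
exists (g ^+ 3) => [|N sN ZN aN [s sP hs]]; first exact: specNX.
pose J : set R^o := [set x | forall v, N ((x : R) *: v)].
have sJ : submodule J.
  apply/submoduleP; split=> [v|a x y Jx Jy v].
    by rewrite scale0r; exact: smod0.
  have -> : (a *: x + y) *: v = a *: ((x : R) *: v) + (y : R) *: v.
    by rewrite scalerDl -scalerA.
  by apply: smodD => //; exact: smodZ.
have PJ x : x \in P -> J x by move=> xP v; exact/ZN/PZ.
(* Duality supplies [w] with [alpha (L_j w)] equal to [t v] for [j = i] and 0 otherwise, modulo [Z].
   So [t y_i v] agrees modulo [Z] with [alpha (F t * x *: w)], an element of [N]. *)
have Jcoef (x : R) (y : nat -> R) : J x ->
    F t * x - \sum_(i < size L) F (y i) * L`_i \in P ->
    forall i, (i < size L)%N -> J (t * y i).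
  move=> Jx hy i iL v; have [w hw] := hdual i v iL.
  have : N (alpha ((F t * x) *: w)).
    by rewrite -scalerA alphaF; apply: smodZ => //; exact/aN/Jx.
  rewrite -[F t * x](subrK (\sum_(i < size L) F (y i) * L`_i)) scalerDl alphaD.
  move=> h; have {h} : N (alpha ((\sum_(i < size L) F (y i) * L`_i) *: w)).
    apply: (smod_subl sN _ _); last by rewrite addrC; exact: h.
    by apply: ZN; apply: alpha_stable; exact: PZ.
  rewrite scaler_suml alpha_sum.
  have -> : (t * y i) *: v = \sum_(j < size L)
      y j *: ((if j == i :> nat then t *: v else 0) - alpha (L`_j *: w))
      + \sum_(j < size L) alpha ((F (y j) * L`_j) *: w).
    rewrite -big_split /= (bigD1 (Ordinal iL)) //= eqxx big1 ?addr0.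
      by rewrite -[in RHS]scalerA alphaF scalerBr subrK scalerA mulrC.
    move=> j ji; rewrite -(inj_eq val_inj) /= in ji.
    by rewrite (negPf ji) -scalerA alphaF sub0r scalerN addNr.
  apply: (smodD sN); apply: (smod_sum sN) => j; apply: smodZ => //.
  by apply: ZN; exact: hw.
have gJ (x : R) : J x -> exists n (u v : nat -> R),
    [/\ forall i, J (u i), forall i, J (v i)
      & g * x - \sum_(i < n) u i * v i \in P].
  move=> Jx; have [y hy] := hL x.
  pose z i := if (i < size L)%N then t * y i else 0.
  have Jz i : J (z i).
    rewrite /z; case: ifP => [iL|_]; last exact: (smod0 sJ).
    exact: (Jcoef x y Jx hy i iL).
  (* Since [q >= 2], both factors of [z i ^+ q = z i ^+ q.-1 * z i] lie in [J]. *)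
  exists (size L), (fun i => z i ^+ q.-1 * L`_i), z; split=> // [i|].
    rewrite mulrC; apply: (smodZ sJ).
    have -> : q.-1 = q.-2.+1 by case: (q) q2 => [|[]].
    by rewrite exprSr; exact: (smodZ sJ _ (Jz i)).
  suff -> : g * x - \sum_(i < size L) z i ^+ q.-1 * L`_i * z i
    = t ^+ q * (F t * x - \sum_(i < size L) F (y i) * L`_i) by exact: specM.
  rewrite mulrBr /g exprMn !Fq mulrA; congr (_ - _).
  rewrite mulr_sumr; apply: eq_bigr => i _.
  by rewrite /z ltn_ord Fq mulrAC -exprSr prednK // exprMn mulrA.
have [a0 ha0] : exists a, J (g ^+ a).
  apply: (power_in_ideal _ sJ PJ gJ hs sP).
  exact: noethR.
(* Write [t v] as [alpha (L_0 w)] modulo [Z]. Passing [g ^+ uphalf a] through [alpha] raises it to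
   the power [q >= 2], hence to exponent at least [a]. The extra factor [g] absorbs [t]. The
   exponent drops strictly as long as it exceeds 3. *)
have reduce a : J (g ^+ a) -> J (g ^+ (uphalf a).+1).
  move=> ha v; have [w hw] := hdual 0 v L0.
  have : N (alpha (g ^+ (uphalf a * q) *: (L`_0 *: w))).
    apply: aN; have le : (a <= uphalf a * q)%N.
      apply: leq_trans (leq_mul (leqnn _) q2); rewrite muln2 -leq_uphalf_double //.
    by rewrite -(subnK le) exprD -scalerA; apply: smodZ => //; exact: ha.
  rewrite exprM alphaZ => h.
  have {h} : N (g ^+ uphalf a *: (t *: v)).
    have := smodD sN (smodZ sN (g ^+ uphalf a) (ZN _ (hw 0 L0))) h.
    by rewrite eqxx scalerBr subrK.
  rewrite exprS.
  have -> : g = t ^+ q.-1 * t ^+ q * t.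
    rewrite /g exprMn -{1}(prednK q0) exprSr; ring.
  move=> h; rewrite -mulrA -scalerA [t * _]mulrC -[(_ * t) *: v]scalerA.
  exact: smodZ.
elim/ltn_ind: a0 ha0 => a IH ha.
have [a3|a3] := leqP a 3.
  by move=> v; rewrite -(subnK a3) exprD -scalerA; apply: smodZ => //; exact: ha.
apply: (IH _ _ (reduce a ha)).
case: a a3 {IH ha} => [|[|[|[|a]]]] // _.
by rewrite /= !ltnS leq_uphalf_double -addnn leq_addr.
Qed.

End GenericContainment.

Local Open Scope ring_scope.

(** * Finiteness of the iterates of Frobenius *)

Section FrobeniusPowers.
Variables (p : nat) (R : comNzRingType) (charR : p \in [pchar R]).

Lemma finite_ring_map_comp (F G H : {rmorphism R -> R}) :
  (forall x, H x = G (F x)) ->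
  finite_ring_map F -> finite_ring_map G -> finite_ring_map H.
Proof.
move=> HE /fg_zspan[s hs] /fg_zspan[t ht]; apply/fg_zspan.
pose st : seq (restrict H R^o) := [seq (G (f : R) * (g : R) : R) | f <- s, g <- t].
exists st; have sX := submodule_zspan0 st.
rewrite eqEsubset; split=> // x _.
have hst (f : R) (g : R) : f \in s -> g \in t -> zspan [set 0] st (G f * g).
  move=> fs gt; apply: (mem_zspan (submodule_set0 _)).
  by apply/allpairsP; exists (f, g).
have hG (y : R) (g : R) : g \in t -> zspan [set 0] st (G y * g).
  move=> gt.
  pose Y : set (restrict F R^o) := [set y | zspan [set 0] st (G (y : R) * g)].
  have sY : submodule Y.
    apply/submoduleP; split.
      by rewrite /Y /= rmorph0 mul0r; exact: (smod0 sX).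
    move=> a u v hu hv; rewrite /Y /=.
    have -> : (a *: u + v : restrict F R^o) = F a * (u : R) + (v : R) by [].
    rewrite rmorphD rmorphM -HE mulrDl -mulrA.
    exact: (smodD sX (smodZ sX a hu) hv).
  have : zspan [set 0] s (y : restrict F R^o) by rewrite -hs.
  apply: (zspan_sub sY) => [_ ->|f fs]; first exact: (smod0 sY).
  exact: hst.
have : zspan [set 0] t (x : restrict G R^o) by rewrite -ht.
have {hst hG} : forall y g : R, g \in t -> zspan [set 0] st (G y * g) := hG.
clear hs ht; move: (st) sX => {}st sX; elim: t x => [|g t IH] x hG /=.
  by move=> ->; exact: (smod0 sX).
move=> [r hr]; apply: (smod_sub sX (v := G r * g)).
  apply: IH hr => y f ft; apply: hG; by rewrite inE ft orbT.
by apply: hG; exact: mem_head.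
Qed.

Lemma frobenius_power e : F_finite charR -> exists2 F : {rmorphism R -> R},
  finite_ring_map F & forall x, F x = x ^+ (p ^ e).
Proof.
move=> FfinR; elim: e => [|e [F finF FE]].
  exists idfun => //; apply/fg_zspan; exists [:: 1].
  rewrite eqEsubset; split=> // x _; exists x.
  suff -> : x *: (1 : restrict idfun R^o) = x by rewrite subrr.
  exact: mulr1.
exists (F \o pFrobenius_aut charR); last first.
  by move=> x /=; rewrite FE pFrobenius_autE -exprM expnS.
exact: (finite_ring_map_comp _ FfinR finF).
Qed.

End FrobeniusPowers.

(** * Uniform denominators for stable submodules *)

Section Operators.
Variables (p : nat) (R : comNzRingType) (V : lmodType R).

(* [S e] consists of [p^{-e}]-linear maps; no additive structure is required.  *)
Record graded_operators (S : nat -> set (V -> V)) : Prop := GradedOperators {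
  operatorD : forall e phi, S e phi -> forall u v, phi (u + v) = phi u + phi v;
  operatorZ : forall e phi, S e phi ->
    forall r v, phi (r ^+ (p ^ e) *: v) = r *: phi v;
  operator_comp : forall d e phi psi, S d phi -> S e psi ->
    S (d + e)%N (phi \o psi);
  operator_id : S 0%N id
}.

Definition stable (S : nat -> set (V -> V)) (X : set V) : Prop :=
  forall e phi, S e phi -> forall v, X v -> X (phi v).

(** The equality [C_+ V = V], as an induction principle: the images of operators of positive degree
    generate [V] as an additive group. *)
Definition F_pure (S : nat -> set (V -> V)) : Prop :=
  forall X : set V, X 0 -> (forall u v, X u -> X v -> X (u + v)) ->
  (forall e phi v, (0 < e)%N -> S e phi -> X (phi v)) -> forall v, X v.

End Operators.

Section UniformDenominator.
Variables (p : nat) (R : comNzRingType) (charR : p \in [pchar R]).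
Hypotheses (noethR : noetherian_ring R) (FfinR : F_finite charR).
Variables (V : lmodType R) (fgV : finitely_generated [set: V]).
Variables (S : nat -> set (V -> V)) (opS : graded_operators p S).
Hypothesis pureS : F_pure S.

Let p_gt1 : (1 < p)%N.
Proof. by apply: prime_gt1; exact: pcharf_prime charR. Qed.

Let p_gt0 e : (0 < p ^ e)%N.
Proof. by rewrite expn_gt0 ltnW. Qed.

Let SD e phi (Sphi : S e phi) := operatorD opS Sphi.
Let SZ e phi (Sphi : S e phi) := operatorZ opS Sphi.

Let Ssplit e phi (Sphi : S e phi) r v :
  r *: phi v = phi ((r ^+ (p ^ e).-1) *: (r *: v)).
Proof. by rewrite -(SZ Sphi) scalerA -exprSr prednK. Qed.

Let S0 e phi : S e phi -> phi 0 = 0.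
Proof. by move=> /SZ /(_ 0 0); rewrite scaler0 scale0r. Qed.

Lemma F_pure_deg m (X : set V) : X 0 -> (forall u v, X u -> X v -> X (u + v)) ->
  (forall e phi v, (m <= e)%N -> S e phi -> X (phi v)) -> forall v, X v.
Proof.
elim: m X => [|m IH] X X0 XD hX.
  by apply: pureS => // e phi v _; exact: hX.
apply: pureS => // e phi v e0 Sphi.
apply: (IH [set u | X (phi u)]) => [|u w hu hw|d psi w md Spsi] /=.
- by rewrite (S0 Sphi).
- by rewrite (SD Sphi); exact: XD.
- apply: (hX (e + d)%N (phi \o psi)); last exact: (operator_comp opS Sphi Spsi).
  by rewrite -add1n leq_add.
Qed.

Variable P : spec R.
Hypothesis P_nilpotent : forall x, x \in P ->
  exists s k, s \notin P /\ forall v : V, (s * x ^+ k) *: v = 0.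

(** By [F_pure_deg], images of operators of degree at least [k] generate [V]. Moving [s * x] inside
    such an operator raises it to the power [p ^ e >= k], which kills [V]. *)
Lemma F_pure_reduced x : x \in P ->
  exists2 s, s \notin P & forall v : V, (s * x) *: v = 0.
Proof.
move=> xP; have [s [k [sP hs]]] := P_nilpotent xP; exists s => //.
apply: (F_pure_deg (m := k)) => [|u v hu hv|e phi v ke Sphi] /=.
- by rewrite scaler0.
- by rewrite scalerDr hu hv addr0.
- rewrite -(SZ Sphi); suff -> : (s * x) ^+ (p ^ e) *: v = 0 by exact: S0 Sphi.
  have kp : (k <= p ^ e)%N.
    by apply: leq_trans ke (ltnW (ltn_expl _ _)).
  have -> : (s * x) ^+ (p ^ e)
     = s ^+ (p ^ e).-1 * x ^+ (p ^ e - k) * (s * x ^+ k).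
    rewrite exprMn -{1}(prednK (p_gt0 e)) exprSr -{2}(subnK kp) exprD; ring.
  by rewrite -scalerA hs scaler0.
Qed.

Variable NN : set (set V).
Hypothesis NN_submodule : forall N, NN N -> submodule N.
Hypothesis NN_stable : forall N, NN N -> stable S N.
Hypothesis NN_generic : forall N, NN N ->
  exists2 s, s \notin P & forall v, N (s *: v).

Let T : set V :=
  [set v | exists2 c, c \notin P & forall N, NN N -> N (c *: v)].

Let sT : submodule T.
Proof.
apply/submoduleP; split.
  exists 1 => [|N /NN_submodule sN]; first exact: spec1.
  by rewrite scaler0; exact: smod0.
move=> a u v [c cP hc] [d dP hd]; exists (c * d) => [|N hN]; first exact: specNM.
have sN := NN_submodule hN.
have -> : (c * d) *: (a *: u + v) = (d * a) *: (c *: u) + c *: (d *: v).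
  by rewrite scalerDr !scalerA; congr (_ *: _ + _); ring.
by apply: smodD => //; apply: smodZ => //; [exact: hc|exact: hd].
Qed.

Let T_stable : stable S T.
Proof.
move=> e phi Sphi v [c cP hc]; exists c => // N hN.
rewrite (Ssplit Sphi); apply: (NN_stable hN Sphi).
by apply: smodZ; [exact: NN_submodule|exact: hc].
Qed.

Let T_sat s v : s \notin P -> T (s *: v) -> T v.
Proof.
move=> sP [c cP hc]; exists (c * s); first exact: specNM.
by move=> N hN; rewrite -scalerA; exact: hc.
Qed.

Let PT x v : x \in P -> T (x *: v).
Proof.
move=> xP; have [s sP hs] := F_pure_reduced xP.
by apply: (T_sat sP); rewrite scalerA hs; exact: smod0.
Qed.

Let T_uniform : exists2 c, c \notin P & forall N v, NN N -> T v -> N (c *: v).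
Proof.
pose Y := [set v | forall N, NN N -> N v].
have sY : submodule Y.
  apply/submoduleP; split=> [N /NN_submodule|]; first exact: smod0.
  move=> a u v hu hv N hN; have sN := NN_submodule hN.
  by apply: smodD => //; [apply: smodZ => //; exact: hu|exact: hv].
have [v [c cP hc]|c cP hc] := fg_uniform (P := P) (fg_submodule noethR fgV sT) sY.
  by exists c.
by exists c => // N v hN /hc; exact.
Qed.

(** The largest [R]-submodule sent into [X]: for a [p^{-e}]-linear [phi], the bare preimage of [X]
    is only stable under [p ^ e]-th powers of scalars. *)
Definition kernel_mod (X : set V) (phi : V -> V) : set V :=
  [set v | forall r, X (phi (r *: v))].

Lemma submodule_kernel_mod X e phi :
  submodule X -> S e phi -> submodule (kernel_mod X phi).
Proof.
move=> sX Sphi; apply/submoduleP; split=> [r|a u v hu hv r].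
  by rewrite scaler0 (S0 Sphi); exact: smod0.
by rewrite scalerDr (SD Sphi) scalerA; apply: smodD.
Qed.

Lemma kernel_mod_sat X e phi : submodule X ->
  (forall s v, s \notin P -> X (s *: v) -> X v) -> S e phi ->
  forall s v, s \notin P -> kernel_mod X phi (s *: v) -> kernel_mod X phi v.
Proof.
move=> sX Xsat Sphi s v sP h r; apply: (Xsat s) => //.
have := h (s ^+ (p ^ e).-1 * r).
by rewrite (Ssplit Sphi) !scalerA -!mulrA [r * s]mulrC.
Qed.

(* If [kernel_mod T phi] does not grow on passing to [phi \o psi \o phi], then *)
(* [psi \o phi] is nondegenerate modulo it.                                    *)
Lemma recurrent_sub e f phi psi : (0 < e)%N -> S e phi -> S f psi ->
  kernel_mod T (phi \o (psi \o phi)) `<=` kernel_mod T phi -> forall v, T (phi v).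
Proof.
move=> e0 Sphi Spsi hZ.
have Salpha : S (f + e)%N (psi \o phi) by exact: (operator_comp opS Spsi Sphi).
have fe0 : (0 < f + e)%N by rewrite addn_gt0 e0 orbT.
have [F finF FE] := frobenius_power (f + e) FfinR.
have sZ := submodule_kernel_mod sT Sphi.
have TZ : T `<=` kernel_mod T phi.
  by move=> v Tv r; apply: (T_stable Sphi); exact: smodZ.
have [||||g gP hg] := generic_containment noethR finF FE _ fgV sZ _
    (kernel_mod_sat sT T_sat Sphi) (SD Salpha) (SZ Salpha).
- by apply: leq_ltn_trans (ltn_expl _ p_gt1).
- by move=> x v xP; apply: TZ; exact: PT.
- move=> v Zv; apply: TZ; apply: (T_stable Spsi).
  by have := Zv 1; rewrite scale1r.
- by move=> v h; apply: hZ => r; have := h r 1; rewrite scale1r.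
have [c cP hc] := T_uniform.
move=> v; exists (c * g) => [|N hN]; first exact: specNM.
have sN := NN_submodule hN.
have [n [z [Nn Zz e1]]] : smod_add N (kernel_mod T phi) (g *: v).
  apply: hg.
  - exact: submodule_add.
  - by move=> z Zz; exists 0, z; split; [exact: smod0| |rewrite add0r].
  - move=> _ [n [z [Nn Zz ->]]]; exists (psi (phi n)), (psi (phi z)); split.
    + exact: NN_stable Salpha _ Nn.
    + by apply: TZ; apply: (T_stable Spsi); have := Zz 1; rewrite scale1r.
    + exact: (SD Salpha).
  - have [s sP hs] := NN_generic hN; exists s => // w.
    by exists (s *: w), 0; split; [|exact: smod0|rewrite addr0].
(* Inside [phi], the scalar [g] becomes [g ^+ (q - 1)] times [g], and [g *: v = n + z]. The term
   from [n] is in [N] by stability; the one from [z] is in [T], which [c] sends into [N]. *)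
rewrite -scalerA (Ssplit Sphi) e1 scalerDr (SD Sphi) scalerDr.
apply: smodD => //; last by apply: hc => //; exact: Zz.
by apply: smodZ => //; apply: (NN_stable hN Sphi); exact: smodZ.
Qed.

Let S_iter e phi j : S e phi -> S (j * e)%N (iter j phi).
Proof.
move=> Sphi; elim: j => [|j IH] /=; first exact: operator_id opS.
by rewrite mulSn; exact: (operator_comp opS Sphi IH).
Qed.

(** The kernels of the iterates ascend, so some iterate of positive degree has the same kernel as
    its cube. Apply [recurrent_sub] with both operators equal to that iterate. *)
Lemma operators_nil e phi : (0 < e)%N -> S e phi ->
  exists j, forall v, T (iter j phi v).
Proof.
move=> e0 Sphi.
have [|j v hv r|n0 hn0] := ascending_stationary noethR fgV
    (X := fun j => kernel_mod T (iter j phi)).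
- by move=> j; exact: submodule_kernel_mod sT (S_iter j Sphi).
- by rewrite iterS; apply: (T_stable Sphi); exact: hv.
exists n0.+1 => v; have hj := S_iter n0.+1 Sphi.
have e1 : (0 < n0.+1 * e)%N by rewrite muln_gt0.
apply: (recurrent_sub e1 hj hj).
have -> : iter n0.+1 phi \o (iter n0.+1 phi \o iter n0.+1 phi)
    = iter (n0.+1 + (n0.+1 + n0.+1)) phi.
  by apply/funext => u; rewrite !iterD.
have le3 : (n0 <= n0.+1 + (n0.+1 + n0.+1))%N.
  exact: leq_trans (leqnSn _) (leq_addr _ _).
by rewrite (hn0 _ le3) (hn0 _ (leqnSn n0)).
Qed.

Theorem uniform_denominator :
  exists2 c, c \notin P & forall N, NN N -> forall v, N (c *: v).
Proof.
suff TV v : T v by have [c cP hc] := T_uniform; exists c => // N hN u; exact: hc.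
apply: contrapT => nTv.
pose FF X := [/\ submodule X, stable S X,
  forall s v, s \notin P -> X (s *: v) -> X v, T `<=` X & X <> setT].
have sFF X : FF X -> submodule X by case.
have FT : FF T by split=> // TT; apply: nTv; rewrite TT.
(* Maximality of [T'] makes [V / T'] simple among stable saturated quotients. By [F]-purity some
   operator of positive degree is nonzero on it; below, [phi] is one with maximal kernel. *)
have [T' [sT' T'_stable T'_sat TT' T'V] T'_max] :=
  noetherian_max noethR fgV (F := FF) sFF FT.
pose G Z := exists e phi,
  [/\ (0 < e)%N, S e phi, ~ (forall v, T' (phi v)) & Z = kernel_mod T' phi].
have [e [phi [e0 Sphi nphi]]] : exists e phi,
    [/\ (0 < e)%N, S e phi & ~ (forall v, T' (phi v))].
  apply: contrapT => h; apply: T'V; rewrite eqEsubset; split=> // u _.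
  apply: pureS => [||e phi w e0 Sphi]; [exact: smod0|by move=> ? ?; exact: smodD|].
  by apply: contrapT => nw; apply: h; exists e, phi; split=> // /(_ w).
have [||_ [{}e [{}phi [{}e0 {}Sphi {}nphi ->]]] Zmax] :=
    noetherian_max noethR fgV (F := G) (X0 := kernel_mod T' phi).
- by move=> _ [d [psi [_ Spsi _ ->]]]; exact: submodule_kernel_mod sT' Spsi.
- by exists e, phi.
have T'Z : T' `<=` kernel_mod T' phi.
  by move=> u Tu r; apply: (T'_stable _ _ Sphi); exact: smodZ.
have phi_psi_phi f psi : S f psi -> forall u, T' (phi (psi (phi u))).
  move=> Spsi; apply: contrapT => nh.
  have Salpha : S (f + e)%N (psi \o phi) by exact: (operator_comp opS Spsi Sphi).
  (* If [phi psi phi] were nonzero modulo [T'], maximality would equate the two kernels. Nilpotence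
     of [psi phi] then descends one iterate at a time until all of [V] lies in the kernel of
     [phi]. *)
  have eZ : kernel_mod T' (phi \o (psi \o phi)) = kernel_mod T' phi.
    apply: Zmax.
      exists (e + (f + e))%N, (phi \o (psi \o phi)); split=> //.
        by rewrite addn_gt0 e0.
      exact: (operator_comp opS Sphi Salpha).
    move=> u hu r /=; apply: (T'_stable _ _ Sphi); apply: (T'_stable _ _ Spsi).
    exact: hu.
  have [|j hj] := operators_nil _ Salpha; first by rewrite addn_gt0 e0 orbT.
  have: forall u, kernel_mod T' phi (iter j (psi \o phi) u).
    by move=> u; exact/T'Z/TT'.
  elim: j {hj} => [|j IH] hj.
    by apply: nphi => u; have := hj u 1; rewrite scale1r.
  apply: IH => u; rewrite -eZ => r /=.
  have := hj (r ^+ (p ^ (j * (f + e))) *: u) 1.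
  by rewrite scale1r iterS (SZ (S_iter j Salpha)).
(* [E] consists of the elements whose generated stable submodule is killed by [phi] modulo [T']. It
   is proper, so simplicity gives [E = T']; yet it contains the image of [phi] by [phi_psi_phi]. *)
pose E : set V := [set u | forall f psi, S f psi ->
  forall r a, T' (phi (r *: psi (a *: u)))].
have T'E : T' `<=` E.
  move=> u Tu f psi Spsi r a; apply: (T'_stable _ _ Sphi); apply: smodZ => //.
  by apply: (T'_stable _ _ Spsi); exact: smodZ.
suff ET' : E = T'.
  apply: nphi => u; rewrite -ET' => f psi Spsi r a.
  rewrite -(SZ Sphi) -(SZ Spsi) -(SZ Sphi); exact: phi_psi_phi Spsi _.
apply: T'_max => //; split.
- apply/submoduleP; split=> [f psi Spsi r a|b u w hu hw f psi Spsi r a].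
    by rewrite scaler0 (S0 Spsi) scaler0 (S0 Sphi); exact: smod0.
  rewrite scalerDr scalerA (SD Spsi) scalerDr (SD Sphi).
  exact: (smodD sT' (hu _ _ Spsi r (a * b)) (hw _ _ Spsi r a)).
- move=> d chi Schi u hu f psi Spsi r a; rewrite -(SZ Schi).
  have := hu _ _ (operator_comp opS Spsi Schi) r (a ^+ (p ^ d)).
  exact.
- move=> s u sP hu f psi Spsi r a; apply: (T'_sat s) => //.
  have := hu _ _ Spsi (s ^+ (p ^ e).-1 * r) (s ^+ (p ^ f).-1 * a).
  have -> : psi ((s ^+ (p ^ f).-1 * a) *: (s *: u)) = s *: psi (a *: u).
    by rewrite (Ssplit Spsi) !scalerA mulrAC.
  by rewrite (Ssplit Sphi) !scalerA mulrAC.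
- exact: subset_trans TT' T'E.
- move=> EV; apply: nphi => u.
  have /(_ _ _ (operator_id opS) 1 1) : E u by rewrite EV.
  by rewrite !scale1r.
Qed.

End UniformDenominator.

Local Open Scope ring_scope.
(** * Stationarity of the Cartier chain *)

Section PrimeIdeals.
Variables (R : comNzRingType) (noethR : noetherian_ring R).
Implicit Types I X : set R^o.

Lemma ring_fg : finitely_generated [set: R^o].
Proof. by apply: noethR; apply/submoduleP; split. Qed.

Lemma spec_of_ideal X : submodule X -> ~ X 1 ->
  (forall x y : R, X (x * y) -> X x \/ X y) ->
  exists P : spec R, forall x : R, x \in P <-> X x.
Proof.
move=> sX X1 XM; pose Xb : R -> bool := fun x => `[< X x >].
have XbP x : x \in Xb <-> X x by split=> [/asboolP|h]; [|apply/asboolP].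
have XbI : idealr_closed Xb.
  split=> [||a u v /XbP Xu /XbP Xv]; first exact/XbP/(smod0 sX).
    by apply/negP => /XbP.
  by apply/XbP; apply: (smodD sX) => //; exact: (smodZ sX a).
have XbM : prime_idealr_closed Xb.
  by move=> u v /XbP/XM[] /XbP ->; rewrite ?orbT.
by exists (Spec XbI XbM).
Qed.

Lemma prime_avoiding I (D : set R) : submodule I -> D 1 ->
  (forall x y, D x -> D y -> D (x * y)) -> (forall x, D x -> ~ I x) ->
  exists2 P : spec R, (forall x, I x -> x \in P) & forall x, D x -> x \notin P.
Proof.
move=> sI D1 DM DI.
pose G X := [/\ submodule X, I `<=` X & forall x, D x -> ~ X x].
have sG X : G X -> submodule X by case.
have GI : G I by split.
have [Q [sQ IQ DQ] Qmax] := noetherian_max noethR ring_fg sG GI.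
have meet (x : R) : ~ Q x -> exists a, exists2 y, Q y & D (y + a * x).
  move=> nQx; apply: contrapT => h; apply: nQx.
  pose Q' : set R^o := [set y | exists a, Q (y - a * x)].
  have QQ' : Q `<=` Q' by move=> y Qy; exists 0; rewrite mul0r subr0.
  have <- : Q' = Q.
    apply: Qmax => //; split; last first.
    - move=> y Dy [a Qy]; apply: h; exists a, (y - a * x) => //.
      by rewrite subrK.
    - exact: subset_trans IQ QQ'.
    - apply/submoduleP; split; first exact: QQ' (smod0 sQ).
      move=> c y z [a hy] [b hz]; exists (c * a + b).
      have -> : c *: y + z - (c * a + b) * x
        = c *: (y - a * x : R^o) + (z - b * x).
        rewrite scalerBr mulrDl opprD -!addrA; congr (_ + _).
        by rewrite addrCA -mulrA.
      exact: (smodD sQ (smodZ sQ c hy) hz).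
  by exists 1; rewrite mul1r subrr; exact: (smod0 sQ).
have [||P hP] := spec_of_ideal sQ.
- exact: DQ.
- move=> x y Qxy; have [Qx|/meet[a [z Qz Dz]]] := pselect (Q x); first by left.
  have [Qy|/meet[b [w Qw Dw]]] := pselect (Q y); first by right.
  case: (DQ _ (DM _ _ Dz Dw)).
  have -> : (z + a * x) * (w + b * y)
    = (w + b * y) * z + (a * x) * w + (a * b) * (x * y) by ring.
  apply: (smodD sQ); last exact: (smodZ sQ).
  by apply: (smodD sQ); exact: (smodZ sQ).
exists P => x; first by move=> /IQ Qx; exact/hP.
by move=> Dx; apply/negP => /hP; exact: DQ.
Qed.

(** Minimality over [I] is expressed as nilpotence modulo [I], locally at [P], of every element of
    [P]. The prime is a maximal proper ideal among the [Q b]. *)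
Lemma minimal_prime p I : p \in [pchar R] -> submodule I -> ~ I 1 ->
  exists2 P : spec R, (forall x, I x -> x \in P) &
    forall x, x \in P -> exists s k, s \notin P /\ I (s * x ^+ k).
Proof.
move=> charR sI I1; have IM (r x : R) : I x -> I (r * x) by exact: (smodZ sI r).
(* [Q b] is the radical of the saturation of [I] by the powers of [b]. *)
pose Q (b : R) : set R^o := [set x | exists k, I (b ^+ k * x ^+ k)].
have Qsub b : submodule (Q b).
  apply/submoduleP; split; first by exists 1; rewrite mulr0; exact: (smod0 sI).
  (* A power of [p] exceeding [k] and [l], so that taking [n]-th powers is additive. *)
  move=> a x y [k hk] [l hl]; pose n := (p ^ (k + l))%N.
  have ltn i : (i < p ^ i)%N.
    by rewrite ltn_expl // prime_gt1 // (pcharf_prime charR).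
  have kn : (k <= n)%N by apply: leq_trans (leq_addr l k) (ltnW (ltn _)).
  have ln : (l <= n)%N by apply: leq_trans (leq_addl k l) (ltnW (ltn _)).
  exists n; have -> : (a *: x + y) ^+ n = a ^+ n * (x : R) ^+ n + (y : R) ^+ n.
    have := @exprDn_pchar R (a * x) y n; rewrite exprMn => -> //.
    by rewrite /n pnatX pnatE ?charR // (pcharf_prime charR).
  have -> : b ^+ n * (a ^+ n * (x : R) ^+ n + (y : R) ^+ n)
    = b ^+ (n - k) * a ^+ n * (x : R) ^+ (n - k) * (b ^+ k * (x : R) ^+ k)
      + b ^+ (n - l) * (y : R) ^+ (n - l) * (b ^+ l * (y : R) ^+ l).
    have split i (z : R) : (i <= n)%N -> z ^+ n = z ^+ (n - i) * z ^+ i.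
      by move=> i_n; rewrite -exprD subnK.
    rewrite mulrDr; congr (_ + _).
      by rewrite (split _ b kn) (split _ (x : R) kn); ring.
    by rewrite (split _ b ln) (split _ (y : R) ln); ring.
  by apply: (smodD sI); exact: IM.
pose G X := exists2 b, X = Q b & ~ Q b 1.
have [||_ [b -> Qb1] Qmax] := noetherian_max noethR ring_fg (F := G) (X0 := Q 1).
- by move=> _ [b ->].
- by exists 1 => // -[k]; rewrite !expr1n mulr1.
have [//||P hP] := spec_of_ideal (Qsub b).
  move=> x y [k hk]; have [|nQx] := pselect (Q b x); first by left.
  right; suff <- : Q (b * x) = Q b by exists k; rewrite exprMn -mulrA -exprMn.
  apply: Qmax; first exists (b * x) => // -[l].
    by rewrite expr1n mulr1 exprMn => hl; apply: nQx; exists l.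
  move=> z [l hl]; exists l; rewrite exprMn mulrAC; rewrite mulrC; exact: IM.
have bP : b \notin P.
  apply/negP => /hP[k hk]; apply: Qb1; exists (k + k)%N.
  by rewrite expr1n mulr1 exprD.
exists P => [x Ix|x /hP[k hk]].
  by apply/hP; exists 1; rewrite !expr1; exact: IM.
by exists (b ^+ k), k; split=> //; exact: specNX.
Qed.

End PrimeIdeals.

Local Open Scope ring_scope.

(** * Multiples annihilated exactly by a prime *)

Section KilledByPrime.
Variables (R : comNzRingType) (noethR : noetherian_ring R) (P : spec R).
Variables (V : lmodType R) (Y : set V) (sY : submodule Y).

(** Multiply by [x] while the annihilator modulo [Y] stays inside [P]. When it first fails to, some
    [t] outside [P] kills [x *: y], and [t *: y] is as wanted. *)
Lemma killed_multiple k x s y : (forall r, Y (r *: y) -> r \in P) ->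
  s \notin P -> Y ((s * x ^+ k) *: y) ->
  exists a, (forall r, Y (r *: (a *: y)) -> r \in P) /\ Y (x *: (a *: y)).
Proof.
move=> + sP; elim: k y => [|k IH] y hy hs.
  by have := hy _ hs; rewrite mulr1 (negPf sP).
have [hxy|/existsNP[t /not_implyP[ht /negP tP]]] :=
    pselect (forall r, Y (r *: (x *: y)) -> r \in P).
  have [|a [ha hxa]] := IH _ hxy.
    by move: hs; rewrite exprSr mulrA -scalerA.
  by exists (a * x); rewrite -!scalerA.
exists t; split=> [r|]; last by rewrite scalerA mulrC -scalerA.
rewrite scalerA => /hy; rewrite (prime_idealrM (spec_pred P)).
by rewrite (negPf tP) orbF.
Qed.

Lemma killed_by_prime y : (forall r, Y (r *: y) -> r \in P) ->
  (forall x, x \in P -> exists s k, s \notin P /\ Y ((s * x ^+ k) *: y)) ->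
  exists a, (forall r, Y (r *: (a *: y)) -> r \in P) /\
    forall x, x \in P -> Y (x *: (a *: y)).
Proof.
move=> hy hP; pose PR : set R^o := [set x | (x : R) \in P].
have sPR : submodule PR.
  apply/submoduleP; split; first exact: spec0.
  by move=> a u v uP vP; apply: specD => //; exact: specM.
have [xs hxs] := (fg_zspan _).1 (noethR sPR).
have [a [ha hxa]] : exists a, (forall r, Y (r *: (a *: y)) -> r \in P) /\
    forall x : R, x \in (xs : seq R^o) -> Y (x *: (a *: y)).
  have : forall x : R, x \in (xs : seq R^o) -> x \in P.
    move=> x xx; have : PR x by rewrite hxs; exact: mem_zspan (submodule_set0 _) xx.
    exact.
  elim: (xs) => [|x l IH] hl.
    by exists 1; split=> // r; rewrite scale1r; exact: hy.
  have [z zl|b [hb hxb]] := IH; first by apply: hl; rewrite inE zl orbT.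
  have [s [k [sP hs]]] := hP x (hl x (mem_head _ _)).
  have [|c [hc hxc]] := killed_multiple (x := x) hb sP (k := k).
    by rewrite scalerA mulrC -scalerA; exact: smodZ.
  exists (c * b); rewrite -scalerA; split=> // z; rewrite inE => /orP[/eqP->//|zl].
  by have := smodZ sY c (hxb z zl); rewrite !scalerA ?mulrA [c * z]mulrC.
exists a; split=> // x xP; pose X : set R^o := [set x | Y ((x : R) *: (a *: y))].
have : PR x by []. rewrite hxs; apply: (zspan_sub (Y := X)) => //.
  apply/submoduleP; split; first by rewrite /X /= scale0r; exact: smod0.
  move=> b u v hu hv; rewrite /X /=.
  have -> : b *: u + v = b * (u : R) + (v : R) by [].
  by rewrite scalerDl -scalerA; apply: smodD => //; exact: smodZ.
by move=> _ ->; rewrite /X /= scale0r; exact: smod0.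
Qed.

End KilledByPrime.

(** * The descending chain and its colon ideals *)

Section Chain.
Variables (p : nat) (R : comNzRingType) (charR : p \in [pchar R]).
Hypothesis noethR : noetherian_ring R.
Variables (V : lmodType R) (fgV : finitely_generated [set: V]).
Variables (S : nat -> set (V -> V)) (opS : graded_operators p S).
Variable X : nat -> set V.
Hypothesis sX : forall n, submodule (X n).
Hypothesis decX : forall n, X n.+1 `<=` X n.
Hypothesis X_gen : forall n e phi v,
  (0 < e)%N -> S e phi -> X n v -> X n.+1 (phi v).
Hypothesis X_ind : forall n (Y : set V),
  Y 0 -> (forall u v, Y u -> Y v -> Y (u + v)) ->
  (forall e phi v, (0 < e)%N -> S e phi -> X n v -> Y (phi v)) -> X n.+1 `<=` Y.

Let decX_le m n : (m <= n)%N -> X n `<=` X m.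
Proof.
move=> /subnK <-; elim: (n - m)%N => [|k IH] // v /decX; exact: IH.
Qed.

Let colon n : set R^o := [set x | forall v, X n v -> X n.+1 ((x : R) *: v)].

Let colon_submodule n : submodule (colon n).
Proof.
apply/submoduleP; split; first by move=> v _; rewrite scale0r; exact: smod0.
move=> a x y hx hy v Xv; have -> : a *: x + y = a * (x : R) + (y : R) by [].
rewrite scalerDl -scalerA.
by apply: smodD => //; [apply: smodZ => //; exact: hx|exact: hy].
Qed.

Let p2 e : (0 < e)%N -> (2 <= p ^ e)%N.
Proof.
have p1 : (1 < p)%N by apply: prime_gt1; exact: pcharf_prime charR.
by move=> e0; rewrite -(exp1n e) ltn_exp2r.
Qed.

Let S0 e phi : S e phi -> phi 0 = 0.
Proof. by move=> /(operatorZ opS) /(_ 0 0); rewrite scaler0 scale0r. Qed.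

(** Moving [x] inside an operator of positive degree raises it to a power [p ^ e >= 2]. *)
Let step m n x : (forall v, X m v -> X n ((x ^+ 2) *: v)) ->
  forall v, X m.+1 v -> X n.+1 (x *: v).
Proof.
move=> h; apply: X_ind => [|u v hu hv|e phi v e0 Sphi Xv] /=.
- by rewrite scaler0; exact: smod0.
- by rewrite scalerDr; exact: smodD.
- rewrite -(operatorZ opS Sphi); apply: (X_gen e0 Sphi).
  by rewrite -(subnK (p2 e0)) exprD -scalerA; apply: smodZ => //; exact: h.
Qed.

Let colon_incr n : colon n `<=` colon n.+1.
Proof.
move=> x hx v; move: v; apply: X_ind => [|u v hu hv|e phi v e0 Sphi Xv] /=.
- by rewrite scaler0; exact: smod0.
- by rewrite scalerDr; exact: smodD.
- rewrite -(operatorZ opS Sphi); apply: (X_gen e0 Sphi).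
  rewrite -(prednK (ltnW (p2 e0))) exprSr -scalerA.
  by apply: smodZ => //; exact: hx.
Qed.

(* If the stable value [I] of [colon] is proper, let [P] be a minimal prime of *)
(* it. For [x] in [I] all [X n] contain [x^2 X n0], so at [P] the chain lives in *)
(* a module of finite length and stops; then [I] is not contained in [P].      *)
(* [Phi Y] says that the chain of the [X n :&: Y] stops at [P].                *)
Theorem chain_stationary : exists n0, forall n, (n0 <= n)%N -> X n = X n0.
Proof.
have [n0 hn0] :=
  ascending_stationary noethR (ring_fg noethR) colon_submodule colon_incr.
have [c1|c1] := pselect (colon n0 1).
  exists n0 => n /subnK <-; elim: (n - n0)%N => // k <-.
  rewrite eqEsubset; split; first exact: decX.
  move=> v Xv; rewrite -[v]scale1r.
  have : colon (k + n0) 1 by rewrite hn0 // leq_addl.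
  exact.
have [P cP Pmin] := minimal_prime noethR charR (colon_submodule n0) c1.
have colonP n s : (n0 <= n)%N -> s \notin P -> ~ colon n s.
  by move=> nn0 sP; rewrite hn0 // => /cP; rewrite (negPf sP).
have square x : colon n0 x ->
    forall n v, (n0 <= n)%N -> X n0 v -> X n ((x ^+ 2) *: v).
  move=> cx n v /subnK <-; elim: (n - n0)%N v => [|k IH] v Xv; first exact: smodZ.
  by rewrite addSn expr2 -scalerA; apply: (step IH); exact: cx.
pose Y0 : set V := [set v | forall n, (n0 <= n)%N -> X n v].
pose Phi (Y : set V) := exists2 n1, (n0 <= n1)%N & forall n, (n1 <= n)%N ->
  exists2 s, s \notin P & forall v, X n v -> Y v -> X n.+1 (s *: v).
pose G Y := [/\ submodule Y, Y0 `<=` Y & Phi Y].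
have sG Y : G Y -> submodule Y by case.
have GY0 : G Y0.
  split=> //.
    apply/submoduleP; split=> [n _|a u v hu hv n nn0]; first exact: smod0.
    by apply: smodD => //; [apply: smodZ => //; exact: hu|exact: hv].
  exists n0 => // n nn0; exists 1; first exact: spec1.
  by move=> v _ Yv; rewrite scale1r; apply: Yv; exact: leqW.
have [Y [sY Y0Y [n1 n01 hn1]] Ymax] := noetherian_max noethR fgV sG GY0.
have [hY|] := pselect (forall y, X n0 y -> exists2 s, s \notin P & Y (s *: y)).
  have [s sP hs] := fg_uniform (fg_submodule noethR fgV (sX n0)) sY hY.
  have [t tP ht] := hn1 n1 (leqnn _).
  case: (colonP n1 (t * s) n01 (specNM tP sP)) => v Xv.
  rewrite -scalerA; apply: ht; first exact: smodZ.
  by apply: hs; exact: decX_le Xv.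
move=> /existsNP[y /not_implyP[Xy ny]].
have [r Yr|x xP|a [ha hPa]] := killed_by_prime noethR sY (P := P) (y := y).
- by apply: contrapT => /negP rP; apply: ny; exists r.
- have [s [k [sP hs]]] := Pmin x xP; exists (s ^+ 2), (k * 2)%N.
  split; first exact: specNX.
  by rewrite exprM -exprMn; apply: Y0Y => n nn0; exact: square.
pose z := a *: y; pose Y' := [set v | exists r, Y (v - r *: z)].
have YY' : Y `<=` Y' by move=> v Yv; exists 0; rewrite scale0r subr0.
have Y'z : Y' z by exists 1; rewrite scale1r subrr; exact: smod0.
suff GY' : G Y'.
  have YY : Y' = Y by exact: Ymax.
  have : Y (1 *: z) by rewrite scale1r -YY.
  by move=> /ha; rewrite (negPf (spec1 P)).
split; [|exact: subset_trans Y0Y YY'|].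
  exact: (submodule_zspan [:: z] sY).
(* At [P] the quotient [Y' / Y] is a line over the residue field. Either every [X n :&: Y'] maps
   onto it, and the line component can be subtracted inside [X n.+1], or from [n2] on the image
   vanishes and only the chain in [Y] matters. *)
have [allP|/existsNP[n2 /not_implyP[n12 hn2]]] := pselect (forall n, (n1 <= n)%N ->
    exists2 s, s \notin P & exists w, Y w /\ X n (s *: z + w)).
  exists n1 => // n nn1.
  have [s sP hs] := hn1 n nn1.
  have [|t tP [w [Yw Xw]]] := allP n.+1; first exact: leqW.
  exists (s * t) => [|v Xv [r Yr]]; first exact: specNM.
  have -> : (s * t) *: v
      = s *: (t *: v - r *: (t *: z + w)) + (s * r) *: (t *: z + w).
    by rewrite scalerBr !scalerA subrK.
  apply: smodD => //; last exact: smodZ.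
  apply: hs.
    by apply: smodB => //; apply: smodZ => //; exact: decX.
  have -> : t *: v - r *: (t *: z + w) = t *: (v - r *: z) - r *: w.
    by rewrite scalerBr scalerDr opprD addrA !scalerA [t * r]mulrC.
  by apply: smodB => //; exact: smodZ.
exists n2 => [|n nn2]; first exact: leq_trans n12.
have [s sP hs] := hn1 n (leq_trans n12 nn2).
exists s => // v Xv [r Yr]; apply: hs => //.
have rP : r \in P.
  apply: contrapT => /negP rP; apply: hn2; exists r => //.
  exists (v - r *: z); split=> //; rewrite addrC subrK.
  exact: decX_le nn2 _ Xv.
by apply: (smod_sub sY Yr); exact: hPa.
Qed.

End Chain.

Local Open Scope ring_scope.
(** * Test modules *)

Section GenericPoints.
Variables (R : comNzRingType) (noethR : noetherian_ring R).
Variables (V : lmodType R) (U : set V).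
Hypotheses (sU : submodule U) (fgU : finitely_generated U).

Let ann : set R^o := [set r | forall v, U v -> (r : R) *: v = 0].

Let sann : submodule ann.
Proof.
apply/submoduleP; split=> [v _|a x y hx hy v Uv]; first exact: scale0r.
have -> : a *: x + y = a * (x : R) + (y : R) by [].
by rewrite scalerDl -scalerA hx // hy // scaler0 addr0.
Qed.

Lemma supp_ann (P : spec R) : (forall r, ann r -> r \in P) -> supp U P.
Proof.
move=> annP U0.
have [v Uv|c cP hc] := fg_uniform (P := P) fgU (submodule_set0 V).
  have : loc_sub P U (Defs.frac v (den1 P)) by exists v => //; exists (den1 P).
  rewrite U0 => /fracP[u]; rewrite !scaler0 scale1r => uv.
  by exists u; [exact: denP|].
by have := annP c hc; rewrite (negPf cP).
Qed.

Lemma zariski_closed_up (P : spec R) :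
  zariski_closed [set Q : spec R | forall r, r \in P -> r \in Q].
Proof. by exists [set r | r \in P]. Qed.

Lemma irreducible_up (P : spec R) :
  irreducible [set Q : spec R | forall r, r \in P -> r \in Q].
Proof.
split; first by exists P.
have up A : zariski_closed A -> A P ->
    [set Q : spec R | forall r, r \in P -> r \in Q] `<=` A.
  by move=> [I ->] /= IP Q PQ r /IP; exact: PQ.
by move=> A B cA cB /(_ P) [] // hP; [left|right]; exact: up.
Qed.

(** Otherwise some prime contains the annihilator of [U] and avoids all [s * x ^+ k]. It lies
    strictly inside [eta], so its closure is a larger irreducible subset of the support. *)
Lemma generic_point_nilpotent eta x : component_generic_point U eta ->
  x \in eta -> exists s k, s \notin eta /\ forall v, U v -> (s * x ^+ k) *: v = 0.
Proof.
move=> [Z [ZU _ Zmax] Zeta] xeta; apply: contrapT => nx.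
pose D : set R := [set y | exists s k, s \notin eta /\ y = s * x ^+ k].
have [|_ _ [s [k [sP ->]]] [t [l [tP ->]]]|_ [s [k [sP ->]]] hsk|P annP DP] :=
    prime_avoiding noethR (D := D) sann.
- by exists 1, 0; split; [exact: spec1|rewrite expr0 mulr1].
- exists (s * t), (k + l)%N; split; first exact: specNM.
  by rewrite exprD; ring.
- by apply: nx; exists s, k.
pose Z' := [set Q : spec R | forall r, r \in P -> r \in Q].
have Peta : Z' eta.
  move=> r rP; apply: contrapT => /negP reta.
  have : r \notin P by apply: DP; exists r, 0; rewrite expr0 mulr1.
  by rewrite rP.
have ZZ' : Z' = Z.
  apply: Zmax; [|exact: irreducible_up|].
    by move=> Q PQ; apply: supp_ann => r /annP; exact: PQ.
  rewrite Zeta => Q; apply; split; first exact: zariski_closed_up.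
  by move=> _ ->.
have etaP r : r \in eta -> r \in P.
  have : Z P by rewrite -ZZ'.
  rewrite Zeta => /(_ [set Q : spec R | forall r, r \in eta -> r \in Q]) h.
  by apply: h; split; [exact: zariski_closed_up|move=> _ ->].
have xP : x \notin P by apply: DP; exists 1, 1; split; [exact: spec1|rewrite mul1r].
by rewrite etaP in xP.
Qed.

End GenericPoints.

(** * A submodule as a module in its own right *)

Section Submodule.
Variables (R : pzRingType) (V : lmodType R) (U : set V).

Definition sub_of (sU : submodule U) : Type := {v : V | v \in U}.

Variable sU : submodule U.

Definition sub_mk v (Uv : U v) : sub_of sU :=
  exist (fun v => v \in U) v (mem_set Uv).

HB.instance Definition _ := SubChoice.on (sub_of sU).
HB.instance Definition _ :=
  GRing.SubChoice_isSubLmodule.Build R V (mem U) (sub_of sU)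
    (GRing.submod_closed_semi sU).

Lemma sub_ofP (u : sub_of sU) : U (val u).
Proof. by have := valP u; rewrite inE. Qed.

End Submodule.

Local Open Scope ring_scope.
Lemma sub_of_fg (R : pzRingType) (V : lmodType R) (U : set V) (sU : submodule U) :
  finitely_generated U -> finitely_generated [set: sub_of sU].
Proof.
move=> /fg_zspan[s Us]; apply/fg_zspan.
pose t := pmap (insub : V -> option (sub_of sU)) s.
exists t; have sT := submodule_zspan0 t.
rewrite eqEsubset; split=> // v _.
pose Y := [set w : V | exists2 u : sub_of sU, val u = w & zspan [set 0] t u].
suff [u /val_inj <-] : Y (val v) by [].
suff UY : U `<=` Y by apply: UY; exact: sub_ofP.
rewrite {1}Us; apply: zspan_sub.
- apply/submoduleP; split; first by exists 0; [exact: raddf0|exact: smod0].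
  move=> a _ _ [x <- hx] [y <- hy]; exists (a *: x + y); first exact: linearP.
  by apply: smodD => //; exact: smodZ.
- by move=> _ ->; exists 0; [exact: raddf0|exact: smod0].
- move=> a sa; have Ua : a \in U.
    by rewrite inE Us; exact: mem_zspan (submodule_set0 V) sa.
  exists (Sub a Ua); first exact: SubK.
  apply: mem_zspan (submodule_set0 _) _.
  by rewrite mem_pmap -(insubT (fun x => x \in U) Ua); exact: map_f.
Qed.

(** * Cartier modules and their test modules *)

Section CartierModules.
Variables (p : nat) (R : comNzRingType) (C : cartierAlgebra p R) (M : lmodType C).

Let V : lmodType R := cartier_module_R M.

Lemma cartier_deg0n e : cartier_deg (c0 := C) e 0.
Proof. by have [] := cartier_deg_zmod C e; rewrite inE. Qed.

Definition cartier_operators (e : nat) : set (V -> V) :=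
  [set phi | exists2 c : C, cartier_deg e c & phi = fun m : V => c *: (m : M)].

Lemma cartier_graded_operators : graded_operators p cartier_operators.
Proof.
split.
- by move=> e _ [c _ ->] u v; exact: (@scalerDr C M c u v).
- move=> e _ [c Cc ->] r v.
  change (c *: (cartier_map C (r ^+ (p ^ e)) *: (v : M))
    = cartier_map C r *: (c *: (v : M))).
  by rewrite !scalerA (cartier_semilinear _ Cc).
- move=> d e _ _ [b Cb ->] [c Cc ->]; exists (b * c); first exact: cartier_degM.
  by apply/funext => m /=; rewrite scalerA.
- exists 1; last by apply/funext => m; rewrite scale1r.
  by rewrite -cartier_deg0; exists 1 => //; exact: rmorph1.
Qed.

Lemma cartier_submodule (X : set M) : submodule X ->
  submodule (X : set V) /\ stable cartier_operators X.
Proof.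
move=> sX; split.
  apply/submoduleP; split; first exact: (smod0 sX).
  move=> a u v Xu Xv; apply: (smodD sX) => //.
  exact: (smodZ sX (cartier_map C a)).
by move=> e _ [c _ ->] v Xv; exact: (smodZ sX).
Qed.

Lemma cartier_plus_deg e (c : C) : (0 < e)%N -> cartier_deg e c -> cartier_plus c.
Proof.
case: e => // e _ Cc; exists e.+1, (fun i => if i == e then c else 0); split.
  by move=> i; case: eqP => [->|_] //; exact: cartier_deg0n.
rewrite (bigD1 ord_max) //= eqxx big1 ?addr0 // => i ie.
by rewrite -(inj_eq val_inj) /= in ie; rewrite (negPf ie).
Qed.

Local Notation cpow := (cartier_pow (M := M)).

Lemma cartier_pow_submodule n : submodule (cpow n).
Proof. exact: submodule_smallest. Qed.

Lemma cartier_pow_decr n : cpow n.+1 `<=` cpow n.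
Proof.
apply: smallest_sub; first exact: cartier_pow_submodule.
move=> _ [phi [m [hphi ->]]] Y [sY GY]; apply: GY.
exists (fun i : 'I_n => phi (widen_ord (leqnSn n) i)), (phi ord_max *: m).
by split=> [i|]; [exact: hphi|rewrite big_ord_recr /= scalerA].
Qed.

Lemma cartier_pow_gen n e (c : C) m : (0 < e)%N -> cartier_deg e c ->
  cpow n m -> cpow n.+1 (c *: m).
Proof.
move=> e0 Cc hm.
pose Y := [set m : M | forall e (c : C), (0 < e)%N -> cartier_deg e c ->
  cpow n.+1 (c *: m)].
suff: Y m by apply; [exact: e0|].
apply: (smallest_sub _ _ hm).
  have sX := cartier_pow_submodule n.+1.
  apply/submoduleP; split; first by move=> *; rewrite scaler0; exact: smod0.
  move=> a u v hu hv d b d0 Cb; rewrite scalerDr.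
  apply: (smodD sX) => //; last exact: (hv _ _ d0 Cb).
  have [k [x [hx ->]]] := cartier_deg_sum a.
  rewrite scalerA mulr_sumr scaler_suml; apply: (smod_sum sX) => i.
  apply: (hu (d + i)%N); first by rewrite addn_gt0 d0.
  exact: cartier_degM.
move=> _ [phi [u [hphi ->]]] d b d0 Cb Z [sZ GZ]; apply: GZ.
exists (fun i : 'I_n.+1 => if unlift ord0 i is Some j then phi j else b), u; split.
  move=> i; case: unliftP => [j _|_]; first exact: hphi.
  exact: cartier_plus_deg Cb.
rewrite big_ord_recl unlift_none scalerA; congr (_ * _ *: _).
by apply: eq_bigr => i _; rewrite liftK.
Qed.

(** The additive span of the homogeneous images is already a [C]-submodule, since a homogeneous
    scalar times a homogeneous element of positive degree again has positive degree. *)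
Lemma cartier_pow_ind n (Y : set M) :
  Y 0 -> (forall u v, Y u -> Y v -> Y (u + v)) ->
  (forall e (c : C) m, (0 < e)%N -> cartier_deg e c -> cpow n m -> Y (c *: m)) ->
  cpow n.+1 `<=` Y.
Proof.
move=> Y0 YD hY.
pose X := [set m : M | forall Z : set M,
  Z 0 -> (forall u v, Z u -> Z v -> Z (u + v)) ->
  (forall e (c : C) m, (0 < e)%N -> cartier_deg e c -> cpow n m -> Z (c *: m)) ->
  Z m].
suff: cpow n.+1 `<=` X by move=> h m /h; exact.
apply: smallest_sub.
  apply/submoduleP; split=> // a u v hu hv Z Z0 ZD hZ.
  apply: (ZD); last exact: (hv Z Z0 ZD hZ).
  apply: (hu [set w | Z (a *: w)]) => /=; first by rewrite scaler0.
    by move=> w w' hw hw'; rewrite scalerDr; exact: ZD.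
  move=> e c m e0 Cc hm; have [k [x [hx ->]]] := cartier_deg_sum a.
  rewrite scalerA mulr_suml scaler_suml; elim/big_ind: _ => // i _.
  by apply: (hZ (i + e)%N) => //; [rewrite addn_gt0 e0 orbT|exact: cartier_degM].
move=> _ [phi [m [hphi ->]]] Z Z0 ZD hZ.
have [k [c [hc e0]]] := hphi ord0.
rewrite big_ord_recl e0 -scalerA scaler_suml; elim/big_ind: _ => // i _.
apply: (hZ i.+1) => // Z' [sZ' GZ']; apply: GZ'.
by exists (fun j => phi (lift ord0 j)), m; split=> // j; exact: hphi.
Qed.

Hypotheses (charR : p \in [pchar R]) (noethR : noetherian_ring R).
Hypothesis cohM : coherent M.

(** Stationarity excludes the default value in [stable_submodule]. *)
Lemma stable_submoduleE :
  exists n0, forall n, (n0 <= n)%N -> cpow n = stable_submodule (M := M).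
Proof.
have [n0 hn0] : exists n0, forall n, (n0 <= n)%N -> cpow n = cpow n0.
  apply: (chain_stationary charR noethR cohM cartier_graded_operators).
  - by move=> n; have [] := cartier_submodule (cartier_pow_submodule n).
  - exact: cartier_pow_decr.
  - by move=> n e _ v e0 [c Cc ->] Xv; exact: (cartier_pow_gen e0 Cc Xv).
  - move=> n Y Y0 YD hY; apply: (cartier_pow_ind Y0 YD) => e c m e0 Cc hm.
    by apply: (hY e (fun m : V => c *: (m : M)) m e0) => //; exists c.
rewrite /stable_submodule; set F := (X in xget _ X).
have : F (cpow n0) by exists n0.
by move=> /(xgetI setT)[n1 hn1]; exists n1.
Qed.

Let U : set V := stable_submodule (M := M).

Lemma stable_submodule_closed : submodule (stable_submodule (M := M)).
Proof.
have [n0 hn0] := stable_submoduleE.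
by rewrite -(hn0 _ (leqnn n0)); exact: cartier_pow_submodule.
Qed.

Let sU : submodule U.
Proof. by have [] := cartier_submodule stable_submodule_closed. Qed.

Let fgU : finitely_generated U. Proof. exact: (fg_submodule noethR cohM sU). Qed.

Lemma stable_submodule_test_candidate : test_candidate (stable_submodule (M := M)).
Proof. by split=> //; exact: stable_submodule_closed. Qed.

Lemma test_candidate_generic N eta : test_candidate N ->
  component_generic_point U eta ->
  exists2 s, s \notin eta & forall v, U v -> (N : set V) (s *: v).
Proof.
move=> [/cartier_submodule[sN _] hN] /hN eN; apply: (fg_uniform fgU sN) => v Uv.
have : loc_sub eta U (Defs.frac v (den1 eta)) by exists v => //; exists (den1 eta).
rewrite /U -eN => -[w Nw [s /fracP[u]]] /= e.
exists (den u * den s); first exact/specNM/denP/denP.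
by rewrite -scalerA e scale1r; exact: smodZ.
Qed.

Hypothesis FfinR : F_finite charR.

Definition sub_operators (e : nat) : set (sub_of sU -> sub_of sU) :=
  [set phi | exists2 c : C, cartier_deg e c &
    forall v, val (phi v) = c *: (val v : M)].

Let valZ (r : R) (u : sub_of sU) : val (r *: u) = r *: (val u : V).
Proof. exact: linearZ. Qed.

Lemma sub_graded_operators : graded_operators p sub_operators.
Proof.
have opS := cartier_graded_operators.
split.
- move=> e phi [c Cc hc] u v; apply: val_inj.
  by rewrite raddfD /= !hc raddfD.
- move=> e phi [c Cc hc] r v; apply: val_inj.
  rewrite hc !valZ hc.
  by apply: (operatorZ opS (e := e) (phi := fun m : V => c *: (m : M))); exists c.
- move=> d e phi psi [b Cb hb] [c Cc hc]; exists (b * c); first exact: cartier_degM.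
  by move=> v /=; rewrite hb hc scalerA.
- exists 1; last by move=> v; rewrite scale1r.
  by rewrite -cartier_deg0; exists 1 => //; exact: rmorph1.
Qed.

Lemma sub_F_pure : F_pure sub_operators.
Proof.
move=> X X0 XD hX v; have [n0 hn0] := stable_submoduleE.
pose Y := [set m : M | exists2 u : sub_of sU, val u = m & X u].
suff [u /val_inj <-] : Y (val v) by [].
have : cpow n0.+1 (val v).
  by rewrite hn0 //; exact: sub_ofP.
apply: cartier_pow_ind.
- by exists 0; first exact: raddf0.
- move=> _ _ [u <- Xu] [w <- Xw]; exists (u + w); [exact: raddfD|exact: XD].
- move=> e c m e0 Cc; rewrite hn0 // => Um.
  have cU (u : sub_of sU) : U (c *: (val u : M)).
    apply: (smodZ stable_submodule_closed); exact: (sub_ofP u).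
  exists (sub_mk sU (cU (sub_mk sU Um))) => //.
  by apply: (hX e (fun u => sub_mk sU (cU u))) => //; exists c.
Qed.

Lemma uniform_test_candidate eta : component_generic_point U eta ->
  exists2 c, c \notin eta & forall N, test_candidate N ->
    forall v, U v -> (N : set V) (c *: v).
Proof.
move=> heta.
have [|N|N|N|c cP hc] := uniform_denominator noethR FfinR (sub_of_fg sU fgU)
    sub_graded_operators sub_F_pure (P := eta) _
    (NN := [set N | exists2 N0 : set V,
      test_candidate N0 & N = [set v | N0 (val v)]]).
- by move=> x xP; have [s [k [sP hs]]] :=
    generic_point_nilpotent noethR fgU heta xP; exists s, k; split=> // v;
  apply: val_inj; rewrite valZ hs ?raddf0 //; exact: sub_ofP.
- move=> [N0 [/cartier_submodule[sN _] _] ->]; apply/submoduleP; split.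
    exact: (smod0 sN).
  move=> a u v hu hv; exact: (smodD sN (smodZ sN a hu) hv).
- move=> [N0 [sN _] ->] e phi [c Cc hc] v Nv; rewrite /= hc.
  exact: (smodZ sN).
- move=> [N0 /test_candidate_generic/(_ heta)[s sP hs] ->]; exists s => // v.
  exact: (hs _ (sub_ofP v)).
- exists c => // N hN v Uv.
  by have := hc _ (ex_intro2 _ _ (N : set V) hN erefl) (sub_mk sU Uv).
Qed.

Theorem test_module_exists_always : test_module_exists M.
Proof.
pose tau := [set m : M | forall N, test_candidate N -> N m].
exists tau; split; last by move=> N hN m; exact.
split.
  apply/submoduleP; split=> [N [sN _]|a u v hu hv N hN]; first exact: smod0.
  have [sN _] := hN; apply: smodD => //; last exact: hv.
  by apply: smodZ => //; exact: hu.
move=> eta heta; rewrite eqEsubset; split=> [x [v hv [s ->]]|x [v Uv [s ->]]].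
  exists v; first exact: hv stable_submodule_test_candidate.
  by exists s.
have [c cP hc] := uniform_test_candidate heta.
(* Expanding the fraction [v / s] by [c] gives a numerator that lies in all candidates. *)
exists (c *: (v : V)); first by move=> N hN; exact: hc.
exists (denM (Denominator cP) s); apply: frac_eq => /=.
by rewrite scalerA mulrC.
Qed.

End CartierModules.

Theorem corollary3p16 (p : nat) (R : comNzRingType)
  (charR : p \in [pchar R]%R)
  (noethR : noetherian_ring R)
  (FfinR : F_finite charR)
  (C : cartierAlgebra p R) (M : lmodType C)
  (cohM : coherent M) :
  ((isomorphic_to_ideal M \/ generic_rank_le1 M) -> test_module_exists M) /\
  (principally_generated C -> test_module_exists M).
Proof.
by split=> _; exact: (test_module_exists_always noethR cohM FfinR).
Qed.
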